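(* In the constrained MDP setting described in the context, suppose the Slater condition and the uniform ergodicity assumption (both stated in the context) hold. Let $\tau,\mu>0$, let $L_\nu:=\lceil\log_\beta(C_M^{-1})\rceil+(1-\beta)^{-1}+1$ and $L_d:=\frac{2R_{\max}^2L_\nu}{(1-\gamma)^2\tau}+\mu$, and run the algorithm AR-CPO (described in the context) for $T$ iterations with $$\alpha=\sqrt{\tfrac{\mu}{2L_d}},\qquad q=\frac{2\alpha-\mu/L_d}{2-\mu/L_d},\qquad \eta=\frac{\alpha}{\mu(1-\alpha)},\qquad B=\frac{r_{0,\max}}{(1-\gamma)\xi}.$$ Let $\lambda^*_{\tau,\mu}:=\operatorname{argmin}_{\lambda\in\mathbb R^m_+}d_{\tau,\mu}(\lambda)$, and $$\Delta_t:=V_0^{\pi^*_{\tau,\underline\lambda_t}}(\rho)+\underline\lambda_t^\top\big(V^{\pi^*_{\tau,\underline\lambda_t}}(\rho)-c\big)-\big[V_0^{\pi_t}(\rho)+\underline\lambda_t^\top(V^{\pi_t}(\rho)-c)\big],$$ $$\delta_t:=\widehat\nabla d_{\tau,\mu}(\underline\lambda_t)-\nabla d_{\tau,\mu}(\underline\lambda_t),\qquad K_0(\lambda):=d_{\tau,\mu}(\bar\lambda_0)-d_{\tau,\mu}(\lambda)+\tfrac{\alpha}{2}\big(\mu+\tfrac1\eta\big)\|\lambda_0-\lambda\|_2^2,$$ $$\zeta_T:=2\Big(1-\sqrt{\tfrac{\mu}{2L_d}}\Big)^{T/2}\sqrt{\eta K_0(\lambda^*_{\tau,\mu})}+\sqrt{8\eta\sqrt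 m\,B\max_{t\in[T]}\|\delta_t\|_2}.$$ Then the output policy $\tilde\pi$ satisfies the optimality gap bound $$V_0^*(\rho)-V_0^{\tilde\pi}(\rho)\le\zeta_T\Big(\tfrac{2R_{\max}}{1-\gamma}+\tfrac{2\sqrt mB}{\eta}\Big)+\sqrt{\tfrac{2L_d}{\mu}}\max_{t\in[T]}|\Delta_t|+\tfrac{\tau\log|\mathcal A|}{1-\gamma}+6\mu mB^2$$ and the constraint violation bound $$\|(c-V^{\tilde\pi}(\rho))_+\|_1\le\zeta_T\Big(\tfrac{2R_{\max}}{(1-\gamma)B}+\tfrac{2\sqrt m}{\eta}\Big)+\sqrt{\tfrac{2L_d}{\mu}}\,\tfrac{\max_{t\in[T]}|\Delta_t|}{B}+\tfrac{\tau\log|\mathcal A|}{(1-\gamma)B}+6\mu mB+2\Big(1-\sqrt{\tfrac{\mu}{2L_d}}\Big)^{T-1}\tfrac{\sqrt mR_{\max}}{1-\gamma}.$$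
   Context: **Constrained MDP.** $\mathcal S$ and $\mathcal A$ are finite state and action spaces, $\mathsf P(\cdot|s,a)$ is a transition kernel, $\gamma\in(0,1)$ a discount factor, $\rho$ the distribution of the initial state $s_0$, $r_0,\dots,r_m:\mathcal S\times\mathcal A\to\mathbb R$ positive finite reward functions, $c=(c_1,\dots,c_m)^\top\in\mathbb R^m$ thresholds. $r_{i,\max}:=\max_{s,a}r_i(s,a)$ and $R_{\max}:=\sqrt{\sum_{i=1}^m r_{i,\max}^2}$. $\Pi$ is the set of stationary policies $\pi(\cdot|s)$. With $a_t\sim\pi(\cdot|s_t)$, $s_{t+1}\sim\mathsf P(\cdot|s_t,a_t)$, set $V_i^\pi(s):=\mathbb E[\sum_{t\ge0}\gamma^tr_i(s_t,a_t)\mid s_0=s]$, $V_i^\pi(\rho):=\mathbb E_{s_0\sim\rho}[V_i^\pi(s_0)]$, $V^\pi(\rho):=(V_1^\pi(\rho),\dots,V_m^\pi(\rho))^\top$. The problem is $\max_{\pi\in\Pi}V_0^\pi(\rho)$ subject to $V_i^\pi(\rho)\ge c_i$, $i=1,\dots,m$; its optimal value is $V_0^*(\rho)$. The discounted visitation distribution is $\nu_\rho^\pi(s,a):=(1-\gamma)\sum_{t\ge0}\gamma^t\Pr\{s_t=s,a_t=a\mid s_0\sim\rho,\pi\}$ and $\chi_\rho^\pi(s):=\sum_{a}\nu_\rho^\pi(s,a)$. $(\cdot)_+$ is the entrywise positive part and $[T]=\{1,\dots,T\}$. **Regularized Lagrangian.** $\mathcal L(\pi,\lambda):=V_0^\pi(\rho)+\langle\lambda,V^\pi(\rho)-c\rangle$;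 $\mathcal H(\pi):=-\mathbb E[\sum_{t\ge0}\gamma^t\log\pi(a_t|s_t)\mid s_0\sim\rho,\pi]$; $\mathcal L_{\tau,\mu}(\pi,\lambda):=\mathcal L(\pi,\lambda)+\tau\mathcal H(\pi)+\frac\mu2\|\lambda\|_2^2$; $d_{\tau,\mu}(\lambda):=\max_{\pi\in\Pi}\mathcal L_{\tau,\mu}(\pi,\lambda)$. $\pi^*_{\tau,\lambda}$ denotes the solution of $\max_{\pi\in\Pi}\mathcal L_{\tau,\mu}(\pi,\lambda)$, i.e. the optimal policy of the $\tau$-entropy-regularized MDP with reward $r_\lambda:=r_0+\sum_{i=1}^m\lambda_ir_i$; it is the softmax policy $\pi^*_{\tau,\lambda}(a|s)\propto\exp(Q^*_{\tau,\lambda}(s,a)/\tau)$, where $Q^*_{\tau,\lambda}$ is the optimal entropy-regularized Q-function, the unique solution of $Q(s,a)=r_\lambda(s,a)+\gamma\mathbb E_{s'\sim\mathsf P(\cdot|s,a)}[\tau\log\sum_{a'}\exp(Q(s',a')/\tau)]$. **Slater condition.** There exist $\xi>0$ and a policy $\pi_\xi\in\Pi$ with $V_i^{\pi_\xi}(\rho)\ge c_i+\xi$ for all $i=1,\dots,m$. **Uniform ergodicity.** Let $\Lambda:=\{\lambda\in\mathbb R^m_+:\lambda_i\le2B,\ i=1,\dots,m\}$. There are constants $C_M>0$, $0<\beta<1$ such that for every $\lambda\in\Lambda$ and $t\ge0$, $\sup_{s\in\mathcal S}d_{TV}(\mathbb P(s_t\in\cdot\mid s_0=s),\chi_{\pi^*_{\tau,\lambda}})\le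 C_M\beta^t$, where the chain is induced by $\pi^*_{\tau,\lambda}$ and $\mathsf P$, $\chi_{\pi^*_{\tau,\lambda}}$ is its stationary distribution, and $d_{TV}$ is total variation distance (half the $\ell_1$ distance). **Algorithm AR-CPO.** Inputs: $T$, $\eta,\alpha,q,\tau,\mu$, accuracy $\delta$, projection radius $B$. Set $\lambda_0=\bar\lambda_0=0$. For $t=1,\dots,T$: $\underline\lambda_t=(1-q)\bar\lambda_{t-1}+q\lambda_{t-1}$; $\pi_t=\mathrm{RegPO}(\delta,\underline\lambda_t,\tau)$, where RegPO is a generic optimizer returning a policy that approximates $\pi^*_{\tau,\underline\lambda_t}$ to accuracy $\delta$ ($\|\pi_t-\pi^*_{\tau,\underline\lambda_t}\|_\infty\le\delta$); $\widehat\nabla d_{\tau,\mu}(\underline\lambda_t)=V^{\pi_t}(\rho)-c+\mu\underline\lambda_t$; $\lambda_t=\operatorname{argmin}_{\lambda\in\Lambda}\{\eta[\langle\widehat\nabla d_{\tau,\mu}(\underline\lambda_t),\lambda\rangle+\frac\mu2\|\lambda-\underline\lambda_t\|_2^2]+\frac12\|\lambda-\lambda_{t-1}\|_2^2\}$; $\bar\lambda_t=(1-\alpha)\bar\lambda_{t-1}+\alpha\lambda_t$. Output $$\tilde\pi(a|s)=\frac{(1-\alpha)^{T-1}\nu_\rho^{\pi_1}(s,a)+\sum_{t=2}^T\alpha(1-\alpha)^{T-t}\nu_\rho^{\pi_t}(s,a)}{(1-\alpha)^{T-1}\chi_\rho^{\pi_1}(s)+\sum_{t=2}^T\alpha(1-\alpha)^{T-t}\chi_\rho^{\pi_t}(s)}$$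 (an arbitrary distribution over actions at states where the denominator vanishes).
   Formalization: The formal theorem additionally assumes L_ν ≥ 1; this follows from uniform ergodicity if |S| ≥ 2 or C_M ≥ 1, and excludes only one-state models with artificially small C_M, where L_d can be negative and α undefined. *)

(* Defs.v *)
From HB Require Import structures.
From mathcomp Require Import all_boot all_order all_algebra.
From mathcomp Require Import all_classical all_reals all_analysis.
From mathcomp Require Import ring lra.

Set Implicit Arguments.
Unset Strict Implicit.
Unset Printing Implicit Defensive.

Import Order.TTheory GRing.Theory Num.Theory.
Import numFieldNormedType.Exports.

Local Open Scope classical_set_scope.
Local Open Scope ring_scope.

Section Distributions.
Context (R : realType).

Record dist (T : finType) := Dist {
  dist_fun :> T -> R;
  dist_ge0 : forall x, 0 <= dist_fun x;
  dist_sum1 : \sum_x dist_fun x = 1 }.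

Lemma ddirac_sum1 (T : finType) (x : T) : \sum_y (y == x)%:R = 1 :> R.
Proof. by rewrite (bigD1 x)//= eqxx big1 ?addr0// => y /negbTE ->. Qed.

Definition ddirac (T : finType) (x : T) : dist T :=
  Dist (fun y => ler0n R (y == x)) (ddirac_sum1 x).

Lemma joint_ge0 (T U : finType) (p : dist T) (k : T -> dist U) (x : T * U) :
  0 <= p x.1 * k x.1 x.2.
Proof. by rewrite mulr_ge0// dist_ge0. Qed.

Lemma joint_sum1 (T U : finType) (p : dist T) (k : T -> dist U) :
  \sum_(x : T * U) p x.1 * k x.1 x.2 = 1.
Proof.
rewrite -(pair_bigA _ (fun x y => p x * k x y))/= -[RHS](dist_sum1 p).
by apply: eq_bigr => x _; rewrite -mulr_sumr dist_sum1 mulr1.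
Qed.

Definition joint (T U : finType) (p : dist T) (k : T -> dist U) : dist (T * U)%type :=
  Dist (joint_ge0 p k) (joint_sum1 p k).

Lemma softmax_gt0 (T : finType) (T0 : (0 < #|T|)%N) (q : T -> R) :
  0 < \sum_y expR (q y).
Proof.
case/card_gt0P: T0 => x _; rewrite (bigD1 x)//=.
by rewrite ltr_wpDr ?expR_gt0// sumr_ge0// => y _; exact: expR_ge0.
Qed.

Lemma softmax_ge0 (T : finType) (q : T -> R) x :
  0 <= expR (q x) / \sum_y expR (q y).
Proof. by rewrite divr_ge0 ?expR_ge0// sumr_ge0// => y _; exact: expR_ge0. Qed.

Lemma softmax_sum1 (T : finType) (T0 : (0 < #|T|)%N) (q : T -> R) :
  \sum_x expR (q x) / \sum_y expR (q y) = 1.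
Proof. by rewrite -mulr_suml divff// gt_eqF// softmax_gt0. Qed.

Definition softmax (T : finType) (T0 : (0 < #|T|)%N) (q : T -> R) : dist T :=
  Dist (softmax_ge0 q) (softmax_sum1 T0 q).

Definition dTV (T : finType) (p q : T -> R) : R := 2^-1 * \sum_x `|p x - q x|.

End Distributions.

Section MarkovProcess.
Context (R : realType).

Definition unif01 : probability (measurableTypeR R) R := uniform_prob (@ltr01 R).

Definition is_markov_chain (F : finType) (p0 : dist R F) (k : F -> dist R F)
    (X : nat -> R -> F) : Prop :=
  (forall t x, measurable (X t @^-1` [set x])) /\
  (forall n (w : nat -> F),
    unif01 [set u | forall i, (i <= n)%N -> X i u = w i] =
    (p0 (w 0%N) * \prod_(i < n) k (w i) (w i.+1))%:E).

Lemma unif01_itv (a b : R) : 0 <= a -> a <= b -> b <= 1 ->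
  unif01 `[a, b[%classic = (b - a)%:E.
Proof.
move=> a0 ab b1; rewrite /unif01 /= /uniform_prob.
rewrite (eq_integral (cst 1%:E)); last first.
  move=> x; rewrite inE/= in_itv/= => /andP[ax xb].
  by rewrite /uniform_pdf (le_trans a0 ax) (ltW (lt_le_trans xb b1))/= subr0 invr1.
rewrite integral_cst//= mul1e lebesgue_measure_itv/= lte_fin.
by move: ab; rewrite le_eqVlt => /predU1P[->|->]; rewrite ?ltxx ?subrr.
Qed.

Let mco (a b : R) : measurable (`[a, b[%classic : set (measurableTypeR R)).
Proof. exact: measurable_itv. Qed.

Lemma unif01_out (A : set (measurableTypeR R)) : measurable A -> A `<=` ~` `[0, 1[%classic -> unif01 A = 0%E.
Proof.
move=> mA sA; apply/eqP; rewrite -measure_le0.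
apply: (@le_trans _ _ (unif01 (~` (`[0, 1[%classic : set (measurableTypeR R))))).
  by apply: le_measure => //; apply/mem_set => //; exact: measurableC.
rewrite le_eqVlt; apply/orP; left; apply/eqP.
transitivity (1 - unif01 (`[0%R, 1%R[%classic : set R))%E.
  exact: (probability_setC unif01 (mco 0 1)).
by rewrite unif01_itv// ?subr0 ?subee.
Qed.

Section construction.
Context (F : finType) (f0 : F) (k : F -> dist R F).
Implicit Types (p : dist R F) (f : F) (u : R).

Let C p n := \sum_(g | (enum_rank g < n)%N) p g.

Let C0 p : C p 0 = 0. Proof. by rewrite /C big_pred0. Qed.

Let CS p f : C p (enum_rank f).+1 = C p (enum_rank f) + p f.
Proof.
rewrite /C (bigD1 f)//= addrC; congr (_ + _); apply: eq_bigl => g.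
rewrite ltnS [in RHS]ltn_neqAle andbC; congr (_ && _).
by rewrite -(inj_eq enum_rank_inj).
Qed.

Let Cle p m n : (m <= n)%N -> C p m <= C p n.
Proof.
move=> mn; rewrite /C [leRHS](bigID (fun g => (enum_rank g < m)%N))/=.
rewrite [in leRHS](eq_bigl (fun g => (enum_rank g < m)%N)); last first.
  by move=> g /=; apply: andb_idl => /leq_trans; exact.
by rewrite lerDl sumr_ge0// => g _; exact: dist_ge0.
Qed.

Let CT p : C p #|F| = 1.
Proof. by rewrite -(dist_sum1 p); apply: eq_bigl => g; rewrite ltn_ord. Qed.

Let cell p f u := C p (enum_rank f) <= u < C p (enum_rank f) + p f.

Let sel p u : F := odflt f0 [pick f | cell p f u].

Let cell_uniq p f g u : cell p f u -> cell p g u -> f = g.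
Proof.
rewrite /cell -!CS => /andP[f1 f2] /andP[g1 g2].
apply: enum_rank_inj; apply/val_inj/eqP; rewrite eqn_leq.
apply/andP; split; rewrite leqNgt; apply/negP => h.
  by have := lt_le_trans g2 (le_trans (Cle p h) f1); rewrite ltxx.
by have := lt_le_trans f2 (le_trans (Cle p h) g1); rewrite ltxx.
Qed.

Let cell_ex p u : 0 <= u < 1 -> exists f, cell p f u.
Proof.
move=> /andP[u0 u1].
have : exists n, u < C p n by exists #|F|; rewrite CT.
move=> /ex_minnP[[|n] un nmin]; first by move: un; rewrite C0 ltNge u0.
have nF : (n < #|F|)%N by apply: nmin; rewrite CT.
exists (enum_val (Ordinal nF)); rewrite /cell -CS enum_valK/= un andbT.
by rewrite leNgt; apply/negP => /nmin; rewrite ltnn.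
Qed.

Let selP p f u : 0 <= u < 1 -> (sel p u = f) <-> cell p f u.
Proof.
move=> u01; rewrite /sel; case: pickP => [g gu|no] /=; last first.
  by have [g] := cell_ex p u01; rewrite no.
by split=> [<-//|fu]; exact: cell_uniq gu fu.
Qed.

Let resc p u := (u - C p (enum_rank (sel p u))) / p (sel p u).

Fixpoint sample (t : nat) p u : F :=
  if t is t'.+1 then sample t' (k (sel p u)) (resc p u) else sel p u.

Let Xproc p t u := if 0 <= u < 1 then sample t p u else f0.

Let sample_itv n p (w : nat -> F) : exists a b : R,
  [/\ 0 <= a, a <= b, b <= 1,
      b - a = p (w 0%N) * \prod_(i < n) k (w i) (w i.+1) &
      forall u, 0 <= u < 1 ->
        (forall i, (i <= n)%N -> sample i p u = w i) <-> a <= u < b].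
Proof.
have Cge0 p' j : 0 <= C p' j by rewrite -(C0 p') Cle.
have Cp1 p' f : C p' (enum_rank f) + p' f <= 1 by rewrite -CS -(CT p') Cle.
elim: n p w => [|n IH] p w.
  exists (C p (enum_rank (w 0%N))), (C p (enum_rank (w 0%N)) + p (w 0%N)).
  split=> //; first by rewrite lerDl dist_ge0.
    by rewrite big_ord0 mulr1 addrAC subrr add0r.
  move=> u u01; split=> [/(_ 0%N isT)/= /selP -/(_ u01)//|].
  by move=> cu [|//] _ /=; apply/selP.
have [a [b [a0 ab b1 ba abP]]] := IH (k (w 0%N)) (fun i => w i.+1).
set f := w 0%N in ba abP *; set c := C p (enum_rank f).
have pf0 := dist_ge0 p f.
have c0 : 0 <= c by exact: Cge0.
have cpf : c + p f <= 1 by exact: Cp1.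
exists (c + p f * a), (c + p f * b); split.
- by rewrite addr_ge0// mulr_ge0.
- by rewrite lerD2l ler_wpM2l.
- by rewrite (le_trans _ cpf)// lerD2l ler_piMr.
- rewrite big_ord_recl/= -/f opprD addrACA subrr add0r -mulrBr ba//.
move=> u u01.
have -> : (forall i, (i <= n.+1)%N -> sample i p u = w i) <->
    (sel p u = f /\
     forall i, (i <= n)%N -> sample i (k f) ((u - c) / p f) = w i.+1).
  split=> [H|[sf H]].
    have sf : sel p u = f := H 0%N isT.
    split=> // i ni; have := H i.+1 ni; rewrite /= /resc sf; exact.
  by move=> [|i] ni //=; rewrite /resc sf; exact: H.
have [pf|pf] := eqVneq (p f) 0.
  split=> [[/selP -/(_ u01)]|].
    by rewrite /cell pf addr0 => /andP[+ /lt_le_trans h] => /h; rewrite ltxx.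
  by rewrite pf !mul0r addr0 => /andP[+ /lt_le_trans h] => /h; rewrite ltxx.
have {}pf0 : 0 < p f by rewrite lt_neqAle eq_sym pf.
have resE x : (x <= (u - c) / p f) = (c + p f * x <= u).
  by rewrite ler_pdivlMr// lerBrDl mulrC.
have resE' x : ((u - c) / p f < x) = (u < c + p f * x).
  by rewrite ltr_pdivrMr// ltrBlDl mulrC.
split=> [[/selP -/(_ u01) cu H]|abu].
  have res01 : 0 <= (u - c) / p f < 1.
    by rewrite resE resE' mulr0 addr0 mulr1.
  by rewrite -resE -resE'; apply/abP.
have abr : a <= (u - c) / p f < b by rewrite resE resE'.
have res01 : 0 <= (u - c) / p f < 1.
  by case/andP: abr => h1 h2; rewrite (le_trans a0 h1) (lt_le_trans h2 b1).
split; last by apply/abP.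
by apply/selP => //; move: res01; rewrite resE resE' mulr0 addr0 mulr1.
Qed.

Lemma markov_chain_exists_subproof p : exists X, is_markov_chain p k X.
Proof.
exists (Xproc p).
pose cyl n (w : nat -> F) := [set u | forall i, (i <= n)%N -> Xproc p i u = w i].
have cylE n w : exists a b : R, [/\ 0 <= a, a <= b, b <= 1,
    b - a = p (w 0%N) * \prod_(i < n) k (w i) (w i.+1) &
    exists2 B : set (measurableTypeR R), measurable B /\ B `<=` ~` `[0, 1[%classic &
      cyl n w = `[a, b[%classic `|` B].
  have [a [b [a0 ab b1 ba abP]]] := sample_itv n p w.
  exists a, b; split=> //.
  exists (cyl n w `&` ~` `[0, 1[%classic).
    split; last by move=> ? [].
    have [wf0|wf0] := pselect (forall i, (i <= n)%N -> w i = f0).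
      rewrite setIidr; first by apply: measurableC; exact: mco.
      move=> u; rewrite /= in_itv/= => /negP/negbTE u01 i ni.
      by rewrite /Xproc u01 wf0.
    rewrite [X in measurable X](_ : _ = set0)// -subset0 => u [cu].
    rewrite /= in_itv/= => /negP/negbTE u01; apply: wf0 => i ni.
    by rewrite -(cu i ni) /Xproc u01.
  apply/seteqP; split=> u /=.
    move=> cu; have [u01|u01] := boolP (0 <= u < 1); last first.
      by right; split=> //; rewrite in_itv/=; apply/negP.
    left; rewrite in_itv/=; apply/abP => // i ni.
    by have := cu i ni; rewrite /Xproc u01.
  case=> [|[]//]; rewrite in_itv/= => /andP[au ub] i ni.
  have u01 : 0 <= u < 1 by rewrite (le_trans a0 au) (lt_le_trans ub b1).
  by rewrite /Xproc u01; have [_ ->//] := abP u u01; rewrite au ub.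
have mcyl n w : measurable (cyl n w : set (measurableTypeR R)).
  have [a [b [_ _ _ _ [B [mB _] ->]]]] := cylE n w.
  by apply: measurableU => //; exact: mco.
split=> [t x|n w].
  pose W (h : {ffun 'I_t.+1 -> F}) i := h (inord i).
  rewrite [X in measurable X](_ : _ =
      \bigcup_(h in [set h : {ffun 'I_t.+1 -> F} | h ord_max = x]) cyl t (W h)).
    by apply: fin_bigcup_measurable => [|h _]; [exact: finite_finset|exact: mcyl].
  apply/seteqP; split=> u /=.
    move=> ux; exists [ffun i : 'I_t.+1 => Xproc p i u]; first by rewrite /= ffunE.
    by move=> i it; rewrite /W ffunE inordK.
  case=> h /= hx /(_ t (leqnn t)) ->; rewrite /W -hx; congr (h _).
  by apply/val_inj; rewrite /= inordK.
have [a [b [a0 ab b1 ba [B [mB sB] E]]]] := cylE n w.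
have dis : `[a, b[%classic `&` B = set0.
  rewrite -subset0 => u []/=; rewrite in_itv/= => /andP[au ub] /sB/=.
  by rewrite in_itv/= (le_trans a0 au) (lt_le_trans ub b1).
rewrite -/(cyl n w) E.
transitivity (unif01 (`[a, b[%classic : set R) + unif01 B)%E.
  exact: (measureU unif01 (mco a b) mB dis).
by rewrite unif01_itv// unif01_out// adde0 ba.
Qed.

End construction.

Lemma markov_chain_exists (F : finType) (p : dist R F) (k : F -> dist R F) :
  exists X, is_markov_chain p k X.
Proof.
have [f0 _|noF] := pickP (@predT F); first exact: markov_chain_exists_subproof f0 k p.
by have := dist_sum1 p; rewrite big_pred0// => /eqP; rewrite eq_sym oner_eq0.
Qed.

(* A Markov chain with initial law p and kernel k, realized on [0, 1] with the
   uniform probability; only its law, fixed by is_markov_chain, is ever used. *)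
Definition markov_chain (F : finType) (p : dist R F) (k : F -> dist R F) :
    nat -> R -> F :=
  sval (cid (markov_chain_exists p k)).

Lemma markov_chainP (F : finType) (p : dist R F) (k : F -> dist R F) :
  is_markov_chain p k (markov_chain p k).
Proof. exact: (svalP (cid (markov_chain_exists p k))). Qed.

End MarkovProcess.

Section Vectors.
Context (R : realType) (m : nat).
Implicit Types u v : 'rV[R]_m.

Definition dot u v : R := \sum_i u 0 i * v 0 i.
Definition norm1 u : R := \sum_i `|u 0 i|.
Definition norm2 u : R := Num.sqrt (\sum_i u 0 i ^+ 2).
Definition pospart u : 'rV[R]_m := \row_i Num.max (u 0 i) 0.
Definition gradient (f : 'rV[R]_m -> R) u : 'rV[R]_m :=
  \row_i 'D_(delta_mx 0 i) f u.

Definition is_argmin (D : set 'rV[R]_m) (f : 'rV[R]_m -> R) u : Prop :=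
  D u /\ forall v, D v -> f u <= f v.

Definition nonneg_orthant : set 'rV[R]_m := [set u | forall i, 0 <= u 0 i].
Definition box (B : R) : set 'rV[R]_m := [set u | forall i, 0 <= u 0 i <= 2 * B].

End Vectors.

Record cmdp (R : realType) (S A : finType) (m : nat) := Cmdp {
  action_gt0 : (0 < #|A|)%N;
  trans : S -> A -> dist R S;
  discount : R;
  init : dist R S;
  reward0 : S -> A -> R;
  reward : 'I_m -> S -> A -> R;
  threshold : 'rV[R]_m;
  discount_gt0 : 0 < discount;
  discount_lt1 : discount < 1;
  reward0_gt0 : forall s a, 0 < reward0 s a;
  reward_gt0 : forall i s a, 0 < reward i s a }.

Definition policy (R : realType) (S A : finType) := S -> dist R A.

Section ConstrainedMDP.
Context (R : realType) (S A : finType) (m : nat) (M : cmdp R S A m).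
Implicit Types (pi : policy R S A) (lam : 'rV[R]_m).

Local Notation gamma := (discount M).

(* The state-action process (s_t, a_t) under pi when s_0 has law p0. *)
Definition trajectory pi (p0 : dist R S) : nat -> R -> S * A :=
  markov_chain (joint p0 pi) (fun x => joint (trans M x.1 x.2) pi).

Definition discounted_sum (f : S -> A -> R) (w : nat -> S * A) : R :=
  limn (series (fun t => gamma ^+ t * f (w t).1 (w t).2)).

Definition expected_sum (f : S -> A -> R) pi (p0 : dist R S) : R :=
  fine ('E_(unif01 R)[fun u => discounted_sum f (trajectory pi p0 ^~ u)])%E.

Definition state_value (f : S -> A -> R) pi (s : S) : R :=
  expected_sum f pi (ddirac R s).

Definition value (f : S -> A -> R) pi : R :=
  \sum_s init M s * state_value f pi s.

Definition V0 pi : R := value (reward0 M) pi.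
Definition V pi : 'rV[R]_m := \row_i value (reward M i) pi.

Definition feasible : set (policy R S A) :=
  [set pi | forall i, threshold M 0 i <= V pi 0 i].

Definition V0_opt : R := sup [set V0 pi | pi in feasible].

Definition slater (xi : R) : Prop :=
  0 < xi /\ exists pi, forall i, threshold M 0 i + xi <= V pi 0 i.

Definition max_reward (f : S -> A -> R) : R :=
  \big[Num.max/0]_(x : S * A) f x.1 x.2.
Definition r0_max : R := max_reward (reward0 M).
Definition R_max : R := Num.sqrt (\sum_i max_reward (reward M i) ^+ 2).

Definition occupancy pi (s : S) (a : A) : R :=
  (1 - gamma) * limn (series (fun t => gamma ^+ t *
    fine (unif01 R [set u | trajectory pi (init M) t u = (s, a)]))).
Definition state_occupancy pi (s : S) : R := \sum_a occupancy pi s a.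

Definition lagrangian pi lam : R := V0 pi + dot lam (V pi - threshold M).

Definition entropy pi : R :=
  - expected_sum (fun s a => ln (pi s a)) pi (init M).

Definition reg_lagrangian (tau mu : R) pi lam : R :=
  lagrangian pi lam + tau * entropy pi + mu / 2 * norm2 lam ^+ 2.

Definition dual (tau mu : R) lam : R :=
  sup [set reg_lagrangian tau mu pi lam | pi in [set: policy R S A]].

Definition lagr_reward lam (s : S) (a : A) : R :=
  reward0 M s a + \sum_i lam 0 i * reward M i s a.

Definition soft_bellman (tau : R) lam (Q : S -> A -> R) : Prop :=
  forall s a, Q s a = lagr_reward lam s a +
    gamma * \sum_s' trans M s a s' * (tau * ln (\sum_a' expR (Q s' a' / tau))).

Definition soft_Q (tau : R) lam : S -> A -> R :=
  get [set Q | soft_bellman tau lam Q].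

Lemma soft_QP (tau : R) lam : 0 < tau ->
  soft_bellman tau lam (soft_Q tau lam) /\
  forall Q, soft_bellman tau lam Q -> Q = soft_Q tau lam.
Proof.
move=> tau0.
pose X : completeNormedModType R := HB.pack 'M[R]_(#|S|, #|A|) (Uniform_isComplete.Build 'M[R]_(#|S|, #|A|) (@cauchy_cvg _)).
pose lse (x : A -> R) := tau * ln (\sum_a expR (x a / tau)).
have sum0 (x : A -> R) : 0 < \sum_a expR (x a / tau) := softmax_gt0 (action_gt0 M) _.
have lse_le (x y : A -> R) e : (forall a, x a <= y a + e) -> lse x <= lse y + e.
  move=> xy; rewrite /lse -ler_pdivlMl// mulrDr mulKf ?gt_eqF//.
  rewrite -[X in _ <= _ + X]expRK -lnM ?posrE ?expR_gt0//.
  rewrite ler_ln ?posrE ?mulr_gt0 ?expR_gt0// mulr_suml.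
  apply: ler_sum => a _; rewrite -expRD ler_expR [tau^-1 * e]mulrC -mulrDl.
  by apply: ler_wpM2r => //; rewrite invr_ge0 ltW.
pose G (x : X) : X := \matrix_(i, j)
  (lagr_reward lam (enum_val i) (enum_val j) + discount M *
    \sum_s' trans M (enum_val i) (enum_val j) s' *
      lse (fun a => x (enum_rank s') (enum_rank a))).
have nE (x : X) : `|x| = \big[Num.max/0]_i `|x i.1 i.2| := mx_normrE x.
have entry (x : X) i j : `|x i j| <= `|x|.
  rewrite nE.
  exact: (le_bigmax _ (fun k => `|x k.1 k.2|) (i, j)).
have norm_le (x : X) e : 0 <= e -> (forall i j, `|x i j| <= e) -> `|x| <= e.
  by move=> e0 xe; rewrite nE; apply/bigmax_leP; split=> // -[i j] _; exact: xe.
have Gc (x y : X) : `|G x - G y| <= discount M * `|x - y|.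
  have g0 := ltW (discount_gt0 M).
  apply: norm_le => [|i j]; first by rewrite mulr_ge0.
  rewrite !mxE opprD addrACA subrr add0r -mulrBr normrM ger0_norm//.
  rewrite ler_wpM2l// -sumrB.
  apply: (le_trans (ler_norm_sum _ _ _)).
  rewrite -[leRHS]mul1r -(dist_sum1 (trans M (enum_val i) (enum_val j))) mulr_suml.
  apply: ler_sum => s' _; rewrite -mulrBr normrM ger0_norm ?dist_ge0//.
  apply: ler_wpM2l; first exact: dist_ge0.
  rewrite (@ler_norml R); apply/andP; split.
    rewrite lerBrDr addrC lerBlDr; apply: lse_le => a.
    rewrite -lerBlDl distrC; apply: le_trans (entry _ (enum_rank s') (enum_rank a)).
    by rewrite !mxE ler_norm.
  rewrite lerBlDl; apply: lse_le => a.
  rewrite -lerBlDl; apply: le_trans (entry _ (enum_rank s') (enum_rank a)).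
  by rewrite !mxE ler_norm.
have [p _ pG] : exists2 p, [set: X] p & p = G p.
  have Gfun : set_fun [set: X] [set: X] G by [].
  pose Gf : {fun [set: X] >-> [set: X]} := HB.pack G (isFun.Build _ _ _ _ _ Gfun).
  have : is_contraction Gf.
    exists (NngNum (ltW (discount_gt0 M))); split; first exact: discount_lt1.
    by move=> [x y] _; exact: Gc.
  by move=> /banach_fixed_point; apply => //; exists 0.
pose mx Q : X := \matrix_(i, j) Q (enum_val i) (enum_val j).
have fixed (Q : S -> A -> R) : soft_bellman tau lam Q <->
    mx Q = G (mx Q).
  have lseE s' : lse (fun a => mx Q (enum_rank s') (enum_rank a)) = lse (Q s').
    by congr lse; apply/funext => a; rewrite mxE !enum_rankK.
  split=> [HQ|/matrixP HQ s a].
    apply/matrixP => i j; rewrite !mxE HQ; congr (_ + _ * _).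
    by apply: eq_bigr => s' _; rewrite lseE.
  have := HQ (enum_rank s) (enum_rank a); rewrite !mxE !enum_rankK => ->.
  congr (_ + _ * _).
  by apply: eq_bigr => s' _; rewrite lseE.
have Qp : soft_bellman tau lam (soft_Q tau lam).
  apply: (@getPex _ [set Q | soft_bellman tau lam Q]).
  exists (fun s a => p (enum_rank s) (enum_rank a)); apply/fixed.
  suff -> : mx (fun s a => p (enum_rank s) (enum_rank a)) = p by [].
  by apply/matrixP => i j; rewrite mxE !enum_valK.
split=> // Q; move: Qp => /fixed Qp /fixed QG.
have : `|mx Q - mx (soft_Q tau lam)| <= 0.
  have := Gc (mx Q) (mx (soft_Q tau lam)).
  rewrite -Qp -QG -subr_ge0 -{2}(mul1r `|_|) -mulrBl.
  by rewrite nmulr_rge0// subr_lt0 discount_lt1.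
rewrite normr_le0 subr_eq0 => /eqP/matrixP e.
apply/funext => s; apply/funext => a.
by have := e (enum_rank s) (enum_rank a); rewrite !mxE !enum_rankK.
Qed.
Definition soft_policy (tau : R) lam : policy R S A :=
  fun s => softmax (action_gt0 M) (fun a => soft_Q tau lam s a / tau).

Definition state_law pi (s : S) (t : nat) (s' : S) : R :=
  fine (unif01 R [set u | (trajectory pi (ddirac R s) t u).1 = s']).

Lemma state_law0 (pi : policy R S A) s s' : state_law pi s 0 s' = (s' == s)%:R.
Proof.
rewrite /state_law /trajectory.
have [mX lawX] := markov_chainP (joint (ddirac R s) pi)
  (fun x => joint (trans M x.1 x.2) pi).
set X := markov_chain _ _ in mX lawX *.
have -> : [set u | (X 0%N u).1 = s'] =
    \bigcup_(a in [set: A]) (X 0%N @^-1` [set (s', a)]).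
  apply/seteqP; split=> u /=; last by case=> a _ /= ->.
  by move=> us'; exists (X 0%N u).2 => //=; rewrite -us'; case: (X 0%N u).
transitivity (fine (\sum_(a \in [set: A]) unif01 R (X 0%N @^-1` [set (s', a)]))%E).
  congr fine; apply: (measure_fin_bigcup (unif01 R)); [exact: finite_finset| |by move=> a _; exact: mX].
  by move=> a b _ _ [u [/= -> []]].
have E a : unif01 R (X 0%N @^-1` [set (s', a)]) = ((s' == s)%:R * pi s' a)%:E.
  have := lawX 0%N (fun=> (s', a)); rewrite big_ord0 mulr1 /= => <-.
  congr (uniform_prob _ _); apply/seteqP; split=> u /=; first by move=> ux [|//].
  by move=> /(_ 0%N); exact.
have TE : [set: A] = [set` enum A] by apply/seteqP; split=> a //= _; rewrite mem_enum.
rewrite TE -fsbig_seq ?enum_uniq// (eq_bigr _ (fun a _ => E a)) sumEFin/=.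
by rewrite -mulr_sumr big_enum/= dist_sum1 mulr1.
Qed.

Definition stationary pi (chi : dist R S) : Prop :=
  forall s', chi s' = \sum_s \sum_a chi s * pi s a * trans M s a s'.

Definition uniformly_ergodic (tau B CM beta : R) : Prop :=
  [/\ 0 < CM, 0 < beta, beta < 1 &
    forall lam, box B lam -> exists2 chi : dist R S,
      stationary (soft_policy tau lam) chi &
      forall t, \big[Num.max/0]_s dTV (state_law (soft_policy tau lam) s t) chi
        <= CM * beta ^+ t].

Definition policy_distance pi pi' : R :=
  \big[Num.max/0]_(x : S * A) `|pi x.1 x.2 - pi' x.1 x.2|.

Definition dual_grad_est (mu : R) pi lam : 'rV[R]_m :=
  V pi - threshold M + mu *: lam.

(* A run of T iterations; RegPO may return any policy meeting its accuracy.
   lamu, lam and lamb are the underlined, plain and overlined iterates. *)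
Record ar_cpo (T : nat) (eta alpha q tau mu delta B : R)
    (pi : nat -> policy R S A) (lamu lam lamb : nat -> 'rV[R]_m) : Prop := ArCpo {
  ar_cpo_lam0 : lam 0%N = 0;
  ar_cpo_lamb0 : lamb 0%N = 0;
  ar_cpo_lamu : forall t, (t < T)%N ->
    lamu t.+1 = (1 - q) *: lamb t + q *: lam t;
  ar_cpo_pi : forall t, (t < T)%N ->
    policy_distance (pi t.+1) (soft_policy tau (lamu t.+1)) <= delta;
  ar_cpo_lam : forall t, (t < T)%N ->
    is_argmin (box B) (fun l =>
      eta * (dot (dual_grad_est mu (pi t.+1) (lamu t.+1)) l +
             mu / 2 * norm2 (l - lamu t.+1) ^+ 2) +
      2^-1 * norm2 (l - lam t) ^+ 2) (lam t.+1);
  ar_cpo_lamb : forall t, (t < T)%N ->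
    lamb t.+1 = (1 - alpha) *: lamb t + alpha *: lam t.+1 }.

Definition mixture (T : nat) (alpha : R) (f : nat -> R) : R :=
  (1 - alpha) ^+ (T - 1) * f 1%N +
  \sum_(2 <= t < T.+1) alpha * (1 - alpha) ^+ (T - t) * f t.

Definition is_output (T : nat) (alpha : R) (pi : nat -> policy R S A)
    (pit : policy R S A) : Prop :=
  forall s a, mixture T alpha (fun t => state_occupancy (pi t) s) != 0 ->
    pit s a = mixture T alpha (fun t => occupancy (pi t) s a) /
              mixture T alpha (fun t => state_occupancy (pi t) s).

End ConstrainedMDP.

(* The term log_beta (1 / CM) is written in base beta < 1. *)
Definition L_nu (R : realType) (CM beta : R) : R :=
  (Num.ceil (ln CM^-1 / ln beta))%:~R + (1 - beta)^-1 + 1.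

(* L_nu < 1 can only happen in the one-state case, with a constant CM < 1. *)
Lemma L_nu_ge1 (R : realType) (S A : finType) (m : nat) (M : cmdp R S A m)
    (tau B CM beta : R) : 0 <= B ->
  (1 < #|S|)%N \/ 1 <= CM ->
  uniformly_ergodic M tau B CM beta -> 1 <= L_nu CM beta.
Proof.
move=> B0 nd [CM0 b0 b1 erg].
have {nd} CM2 : 2^-1 <= CM.
  case: nd => [S2|]; last by apply: le_trans; rewrite invf_le1// ler1n.
  have [chi _ /(_ 0%N)] := erg 0 ltac:(by move=> i; rewrite mxE lexx/= mulr_ge0).
  rewrite expr0 mulr1 => /(le_trans _); apply.
  have [s chis] : exists s, chi s <= 2^-1.
    have [s [s' ss']] : exists s s' : S, s != s'.
      by move: S2 => /card_gt1P[s [s' [_ _ ?]]]; exists s, s'.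
    have := dist_sum1 chi; rewrite (bigD1 s)//= (bigD1 s')//= 1?eq_sym//.
    set r := (X in _ + (_ + X)).
    have r0 : 0 <= r by rewrite sumr_ge0// => i _; exact: dist_ge0.
    move=> r1; have [?|h1] := leP (chi s) 2^-1; first by exists s.
    have [?|h2] := leP (chi s') 2^-1; first by exists s'.
    exfalso; move: r0 r1 h1 h2; move: r (chi s) (chi s') => x y z; lra.
  apply: (le_trans _ (le_bigmax _ _ s)) => /=.
  rewrite /dTV -[leLHS]mulr1 ler_pM2l// (bigD1 s)//=.
  have := dist_sum1 chi; rewrite (bigD1 s)//= => chi1.
  rewrite state_law0 eqxx (eq_bigr chi) => [|i /negbTE is_]; last first.
    by rewrite state_law0 is_ sub0r normrN ger0_norm ?dist_ge0.
  by rewrite mulr1n ger0_norm; lra.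
have lnb : ln beta < 0 by rewrite ln_lt0// b0.
have lnbb : ln beta <= beta - 1.
  have := @le_ln1Dx R (beta - 1); rewrite addrCA subrr addr0; apply.
  by rewrite ltrBrDl subrr.
have lnC : ln CM^-1 <= 1.
  have : ln CM^-1 <= ln 2.
    by rewrite ler_ln ?posrE ?invr_gt0// -[leRHS]invrK lef_pV2// posrE invr_gt0.
  by move=> /le_trans; apply; have := @le_ln1Dx R 1; rewrite -[1+1]/2; apply; lra.
rewrite /L_nu -[leLHS]add0r lerD2r.
have h : (ln beta)^-1 <= ln CM^-1 / ln beta.
  by rewrite -[leLHS]mul1r ler_nM2r ?invr_lt0.
have h2 : - (1 - beta)^-1 <= (ln beta)^-1.
  by rewrite -invrN lef_nV2 ?negrE//; lra.
have h3 := ceil_ge (ln CM^-1 / ln beta); lra.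
Qed.

(* Main.v *)
(* Write theta = 1 - alpha, and for a fixed multiplier l in the box put
   E_t = d(lamb_t) + mu/2 |l - lam_t|^2.  One accelerated step on the dual d gives
     E_t <= theta E_(t-1) + alpha (L(pi_t, l) + Delta_t + entropy + mu/2 |l|^2 + error),
   because the linearization of d at lamu_t, evaluated at l, is the regularized Lagrangian of
   the soft-optimal policy at l.  As lamu_1 = 0, d(0) is V0(pi_1) up to Delta_1 and entropy, so
   unrolling puts the total weight theta^(T-1) on pi_1: these are the weights of the output
   policy, and V0_opt <= d(lamb_T) <= L(pit, l) - theta^T <l, V(pi_1) - c> + errors.  Taking
   l = 0 bounds the gap; taking l_i = 2B on the violated constraints bounds the violation,
   since mixing pit with the Slater policy shows V0_opt >= V0(pit) - B * violation.

   Smoothness of d: for f = sum_i (lam' - lam)_i r_i, the performance difference lemma bounds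
   the change of the gradient along lam' - lam by the total variation distance of the two
   softmax policies times the span of the action value of f, and mixing bounds that span by
   4 L_nu times the span of f. *)
Require Import Defs.
From mathcomp Require Import all_boot all_order all_algebra.
From mathcomp Require Import all_classical all_reals all_analysis.
From mathcomp Require Import measurable_realfun ring lra.

Set Implicit Arguments.
Unset Strict Implicit.
Unset Printing Implicit Defensive.

Import Order.TTheory GRing.Theory Num.Theory.
Import numFieldNormedType.Exports.

Local Open Scope classical_set_scope.
Local Open Scope ring_scope.

(** * Marginals and discounted expectations of a Markov chain *)

(** The process is known only through the probabilities of finite paths. It is used until the
    marginals obey a one-step recursion and the values a Bellman equation; after that, values are
    compared by exhibiting sub- and supersolutions of this equation, and laws of states return only
    for mixing. Budget of the smoothness constant: the softmax bound brings 1 / (2 tau (1 - gamma)),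
    the performance difference another 1 / (1 - gamma), and the span of f is at most R_max |lam' -
    lam|. With the factor 4 L_nu the product is exactly Ld - mu. The remainder is bounded by the
    whole variation of the gradient instead of half of it, so d lies below a quadratic with
    coefficient Ld - mu/2; the 2 in alpha^2 = mu / (2 Ld) pays for this. The one-step inequality
    holds for every l in the box, not only for the minimizer of d, so l may be chosen once the
    output policy is known. The side 2B lets the penalty exceed by B the price B per unit of
    violation that the Slater policy gives. *)

Section MarkovLaw.
Context (R : realType) (F : finType) (p0 : dist R F) (k : F -> dist R F)
  (X : nat -> R -> F) (chainX : is_markov_chain p0 k X).

Local Notation U := (unif01 R).

Definition marginal t x : R := fine (U [set u | X t u = x]).

Let mX t x : measurable (X t @^-1` [set x] : set (measurableTypeR R)).
Proof. by case: chainX => + _; exact. Qed.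

Let U_finite (A : set (measurableTypeR R)) : measurable A -> U A = (fine (U A))%:E.
Proof. by move=> mA; rewrite fineK// fin_num_measure. Qed.

(** Measurability is asked of the intersections only, so that [Y] may be a whole finite path. *)
Lemma chain_total_prob (J : finType) (Y : R -> J) (A : set (measurableTypeR R)) :
  (forall j, measurable (A `&` [set u | Y u = j] : set (measurableTypeR R))) ->
  U A = (\sum_j U (A `&` [set u | Y u = j]))%E.
Proof.
move=> mA.
have AE : A = \bigcup_(j in [set: J]) (A `&` [set u | Y u = j]).
  apply/seteqP; split=> u /=; first by move=> Au; exists (Y u).
  by case=> j _ [].
transitivity (\sum_(j \in [set: J]) U (A `&` [set u | Y u = j]))%E.
  rewrite {1}AE.
  apply: (measure_fin_bigcup U); [exact: finite_finset| |by move=> j _].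
  by move=> i j _ _ [u [[_ /= <-] [_ /= <-]]].
have TE : [set: J] = [set` enum J] by apply/seteqP; split=> a //= _; rewrite mem_enum.
by rewrite TE -fsbig_seq ?enum_uniq// big_enum.
Qed.

Let cyl n (w : nat -> F) : set (measurableTypeR R) :=
  [set u | forall i, (i <= n)%N -> X i u = w i].

Let mcyl n w : measurable (cyl n w).
Proof.
have -> : cyl n w = \bigcap_(i in [set i | (i <= n)%N]) (X i @^-1` [set w i]).
  by apply/seteqP; split=> u /= H i /= ni; exact: H.
by apply: bigcap_measurableType => i _; exact: mX.
Qed.

(** The law of the chain is stated for words indexed by [nat], while summation needs the finite type
    of paths up to [t]; [y] fills the later positions, in particular [t.+1]. *)
Let ext t (h : {ffun 'I_t.+1 -> F}) y i : F :=
  if (i <= t)%N then h (inord i) else y.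

Let path_upto t u : {ffun 'I_t.+1 -> F} := [ffun i : 'I_t.+1 => X i u].

Let path_uptoE t h u : path_upto t u = h <-> (forall i, (i <= t)%N -> X i u = h (inord i)).
Proof.
split=> [<- i it|H]; first by rewrite ffunE inordK.
by apply/ffunP => i; rewrite ffunE (H i (leq_ord i)) inord_val.
Qed.

(* Conditioning on the whole path up to time t, as the law of the chain is only given on paths. *)
Lemma marginal_step t y : marginal t.+1 y = \sum_x marginal t x * k x y.
Proof.
have path2 (h : {ffun 'I_t.+1 -> F}) y' : [set u | path_upto t u = h] `&` [set u | X t.+1 u = y'] =
    cyl t.+1 (ext h y').
  apply/seteqP; split=> u /=.
    move=> [/path_uptoE H <-] i; rewrite /ext leq_eqVlt => /predU1P[->|].
      by rewrite ltnn.
    by rewrite ltnS => it; rewrite it H.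
  move=> H; split; last by rewrite H//= /ext ltnn.
  by apply/path_uptoE => i it; rewrite H 1?ltnW// /ext it.
have path1 (h : {ffun 'I_t.+1 -> F}) y' : [set u | path_upto t u = h] = cyl t (ext h y').
  apply/seteqP; split=> u /=.
    by move=> /path_uptoE H i it; rewrite H// /ext it.
  by move=> H; apply/path_uptoE => i it; rewrite H// /ext it.
have joint2 (h : {ffun 'I_t.+1 -> F}) :
    fine (U (cyl t.+1 (ext h y))) = fine (U (cyl t (ext h y))) * k (h ord_max) y.
  case: chainX => _ law; rewrite /cyl !law /= big_ord_recr/= mulrA.
  congr (_ * k _ _); rewrite /ext ?ltnn ?leqnn//.
  by congr (h _); apply: val_inj; rewrite /= inordK.
have mpath (h : {ffun 'I_t.+1 -> F}) :
    measurable ([set u | path_upto t u = h] : set (measurableTypeR R)).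
  by rewrite (path1 h y).
rewrite /marginal.
rewrite (@chain_total_prob _ (path_upto t)); last first.
  by move=> h; apply: measurableI => //; exact: mX.
rewrite (eq_bigr (fun h : {ffun 'I_t.+1 -> F} =>
    (fine (U (cyl t (ext h y))) * k (h ord_max) y)%:E)); last first.
  by move=> h _; rewrite setIC path2 U_finite// joint2.
rewrite sumEFin/= (partition_big (fun h : {ffun 'I_t.+1 -> F} => h ord_max) predT)//=.
apply: eq_bigr => x _; rewrite (eq_bigr (fun h => fine (U (cyl t (ext h y))) * k x y)).
  2: by move=> h /eqP ->.
rewrite -mulr_suml; congr (_ * _).
rewrite (@chain_total_prob _ (path_upto t)); last first.
  by move=> h; apply: measurableI => //; exact: mX.
rewrite [in RHS](bigID (fun h : {ffun 'I_t.+1 -> F} => h ord_max == x))/=.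
rewrite [X in (_ + X)%E]big1 ?adde0.
  rewrite [in RHS](eq_bigr (fun h => (fine (U (cyl t (ext h y))))%:E)) ?sumEFin//.
  move=> h /eqP hx; rewrite -U_finite// -(path1 h y); congr (U _).
  apply/seteqP; split=> u /= => [[]//|pu]; split=> //.
  move/path_uptoE: pu => /(_ t (leqnn _)) ->; rewrite -hx; congr (h _).
  by apply: val_inj; rewrite /= inordK.
move=> h /eqP hx; rewrite (_ : _ `&` _ = set0) ?measure0//.
rewrite -subset0 => u /= [Xx /path_uptoE/(_ t (leqnn _))]; rewrite Xx => xh.
apply: hx; rewrite xh; congr (h _).
by apply: val_inj; rewrite /= inordK.
Qed.

Lemma marginal0 x : marginal 0 x = p0 x.
Proof.
case: chainX => _ law; rewrite /marginal.
have := law 0%N (fun=> x); rewrite big_ord0 mulr1.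
rewrite (_ : [set u | _] = [set u | X 0%N u = x]) => [->//|].
apply/seteqP; split=> u /=; first by move/(_ 0%N); exact.
by move=> ux [|//].
Qed.

Section DiscountedExpectation.
Context (gamma : R) (gamma0 : 0 <= gamma) (gamma1 : gamma < 1) (g : F -> R).

Let G := \sum_x `|g x|.
Let gG x : `|g x| <= G.
Proof. by rewrite /G (bigD1 x)//= lerDl sumr_ge0. Qed.

Let psum n u : R := \sum_(0 <= t < n) gamma ^+ t * g (X t u).
Let lsum u : R := limn (series (fun t => gamma ^+ t * g (X t u))).


Let normE : `|gamma| < 1. Proof. by rewrite ger0_norm. Qed.

Let bound := series (geometric G gamma).

Let psum_le n u : `|psum n u| <= G * (1 - gamma)^-1.
Proof.
have -> : G * (1 - gamma)^-1 = limn bound.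
  by apply/esym/cvg_lim => //; exact: cvg_geometric_series.
apply: le_trans (_ : bound n <= _); last first.
  apply: nondecreasing_cvgn_le; last exact: is_cvg_geometric_series.
  apply: nondecreasing_series => i _ _.
  (* [X 0 0] serves only as an element of [F], which gives 0 <= [G]. *)
  by rewrite /geometric/= mulr_ge0 ?exprn_ge0// (le_trans _ (gG (X 0%N 0))).
apply: le_trans (ler_norm_sum _ _ _) _; apply: ler_sum => t _.
by rewrite normrM normrX ger0_norm// /geometric /= mulrC ler_wpM2r ?exprn_ge0.
Qed.

Let psum_cvg u : psum ^~ u @ \oo --> lsum u.
Proof.
apply: normed_cvg.
apply: (@series_le_cvg _ _ (geometric G gamma)) => [n|n|n|].
- exact: normr_ge0.
- by rewrite /geometric/= mulr_ge0 ?exprn_ge0// (le_trans _ (gG (X 0%N 0))).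
- by rewrite /= normrM normrX ger0_norm// /geometric /= mulrC ler_wpM2r ?exprn_ge0.
- exact: is_cvg_geometric_series.
Qed.

Let gE t u : g (X t u) = \sum_x g x * \1_([set u | X t u = x] : set (measurableTypeR R)) u.
Proof.
rewrite (bigD1 (X t u))//= big1 ?addr0 => [|x xX]; rewrite indicE.
  by rewrite mem_set ?mulr1.
by rewrite memNset ?mulr0//= => E; rewrite E eqxx in xX.
Qed.

Let mg t : measurable_fun [set: measurableTypeR R] (fun u => g (X t u)).
Proof.
rewrite (_ : (fun u => _) = fun u =>
    \sum_x g x * \1_([set u | X t u = x] : set (measurableTypeR R)) u); last first.
  by apply/funext => u; exact: gE.
apply: measurable_sum => x; apply: measurable_funM; first exact: measurable_cst.
by apply: measurable_indic; exact: mX.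
Qed.

Let mpsum n : measurable_fun [set: measurableTypeR R] (psum n).
Proof.
apply: measurable_sum => t; apply: measurable_funM => //; exact: measurable_cst.
Qed.

Let int_indic t x : (\int[U]_(u in [set: measurableTypeR R])
  (\1_([set u | X t u = x] : set (measurableTypeR R)) u)%:E = (marginal t x)%:E)%E.
Proof.
by rewrite (@integral_indic _ _ _ U _ measurableT _ (mX t x)) setIT; exact: (U_finite (mX t x)).
Qed.

Let integrable_ind (c : R) t x : U.-integrable [set: measurableTypeR R]
  (fun u => (c * \1_([set u | X t u = x] : set (measurableTypeR R)) u)%:E).
Proof.
under eq_fun do rewrite EFinM.
apply: integrableZl => //.
exact: (@integrable_indic _ _ _ U _ (mX t x)).
Qed.

Let int_psum n : (\int[U]_(u in [set: measurableTypeR R]) (psum n u)%:E =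
  (\sum_(0 <= t < n) gamma ^+ t * \sum_x marginal t x * g x)%:E)%E.
Proof.
transitivity (\int[U]_(u in [set: measurableTypeR R])
   \sum_(0 <= t < n) \sum_x ((gamma ^+ t * g x) *
     \1_([set u | X t u = x] : set (measurableTypeR R)) u)%:E)%E.
  apply: eq_integral => u _; rewrite /psum -sumEFin; apply: eq_bigr => t _.
  by rewrite gE sumEFin mulr_sumr; congr EFin; apply: eq_bigr => x _; rewrite mulrA.
rewrite integral_sum//; last first.
  by move=> t; apply: integrable_sum => // x _; exact: integrable_ind.
rewrite -sumEFin; apply: eq_bigr => t _.
rewrite integral_sum//.
rewrite mulr_sumr -sumEFin; apply: eq_bigr => x _.
under eq_integral do rewrite EFinM.
rewrite integralZl//; last exact: (@integrable_indic _ _ _ U _ (mX t x)).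
by rewrite int_indic -EFinM -mulrA (mulrC (g x)).
Qed.

(** Dominated convergence: the partial sums are bounded by [G] / (1 - gamma) on every path. The
    conclusion is a convergence, so that later identities follow from partial sums by uniqueness of
    limits. *)
Lemma discounted_expectation_cvg :
  series (fun t => gamma ^+ t * \sum_x marginal t x * g x) @ \oo -->
  fine ('E_(unif01 R)[fun u => limn (series (fun t => gamma ^+ t * g (X t u))%R)])%E.
Proof.
have [|||||iL _] := @dominated_convergence _ (measurableTypeR R) R U setT measurableT
    (fun n u => (psum n u)%:E) (fun u => (lsum u)%:E) (fun=> (G * (1 - gamma)^-1)%:E).
- by move=> n; apply/measurable_EFinP; exact: mpsum.
- apply/measurable_EFinP; apply: (measurable_fun_cvg mpsum) => u _; exact: psum_cvg.
- apply: aeW => u _; apply: cvg_EFin; [exact: nearW|exact: psum_cvg].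
- exact: (@finite_measure_integrable_cst _ _ _ U).
- by apply: aeW => u n _; rewrite lee_fin psum_le.
have -> : [sequence (\int[U]_(x in setT) (psum n x)%:E)%E]_n =
  (fun n => (series (fun t => gamma ^+ t * \sum_x marginal t x * g x) n)%:E).
  by apply/funext => n; rewrite /= int_psum.
rewrite expectation.unlock => H.
have fin : (\int[U]_(u in [set: measurableTypeR R]) (lsum u)%:E)%E \is a fin_num.
  exact: (@integrable_fin_num _ _ _ U _ measurableT _ iL).
by rewrite -(fineK fin) in H; exact: (fine_cvg H).
Qed.
End DiscountedExpectation.
End MarkovLaw.

(** * Policy values *)

Section DistMean.
Context (R : realType) (T : finType).
Implicit Types (p q : dist R T) (f g : T -> R).

(** The weight is a bare function, to cover state marginals, which are not packaged as [dist]. *)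
Definition mean (p : T -> R) f : R := \sum_x p x * f x.

Lemma ler_mean p f g : (forall x, f x <= g x) -> mean p f <= mean p g.
Proof. by move=> fg; apply: ler_sum => x _; rewrite ler_wpM2l ?dist_ge0. Qed.

Lemma meanD p f g : mean p (fun x => f x + g x) = mean p f + mean p g.
Proof. by rewrite -big_split; apply: eq_bigr => x _; rewrite mulrDr. Qed.

Lemma meanZ p c f : mean p (fun x => c * f x) = c * mean p f.
Proof. by rewrite /mean mulr_sumr; apply: eq_bigr => x _; rewrite mulrCA. Qed.

Lemma mean_cst p c : mean p (fun=> c) = c.
Proof. by rewrite /mean -mulr_suml dist_sum1 mul1r. Qed.

Lemma mean_ddirac x f : mean (ddirac R x) f = f x.
Proof.
rewrite /mean (bigD1 x)//= eqxx mul1r big1 ?addr0// => y /negbTE ->.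
by rewrite mul0r.
Qed.

Lemma eq_mean p f g : (forall x, f x = g x) -> mean p f = mean p g.
Proof. by move=> fg; apply: eq_bigr => x _; rewrite fg. Qed.

Lemma cvg_mean (p : T -> R) (F : T -> nat -> R) f : (forall x, F x @ \oo --> f x) ->
  (fun n => mean p (F ^~ n)) @ \oo --> mean p f.
Proof.
move=> Ff; rewrite /mean; apply: cvg_big => [|x _]; first exact: add_continuous.
by apply: cvgMl_tmp; exact: Ff.
Qed.

End DistMean.

Section PolicyValues.
Context (R : realType) (S A : finType) (m : nat) (M : cmdp R S A m).
Implicit Types (pi : policy R S A) (f : S -> A -> R) (u v : S -> R).

Local Notation gamma := (discount M).

Definition action_value f u s a : R := f s a + gamma * mean (trans M s a) u.

Definition state_step pi (p : S -> R) : S -> R :=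
  fun s' => \sum_s \sum_a p s * pi s a * trans M s a s'.

Definition state_marginal pi (p : S -> R) t : S -> R := iter t (state_step pi) p.

(** The kernel draws the action from [pi] given the new state, so the factorization is preserved by
    a step and only the state law has to be propagated. *)
Lemma trajectory_marginal pi (p : dist R S) t s a :
  marginal (trajectory M pi p) t (s, a) = state_marginal pi p t s * pi s a.
Proof.
have chainX := markov_chainP (joint p pi) (fun x => joint (trans M x.1 x.2) pi).
elim: t s a => [|t IH] s a; first by rewrite (marginal0 chainX).
rewrite (marginal_step chainX) /= -/(trajectory M pi p) /state_step.
rewrite pair_bigA mulr_suml; apply: eq_bigr => -[s' a'] _ /=.
by rewrite IH mulrA.
Qed.

Lemma expected_sum_cvg f pi (p : dist R S) :
  series (fun t => gamma ^+ t * mean (state_marginal pi p t) (fun s => mean (pi s) (f s)))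
    @ \oo --> expected_sum M f pi p.
Proof.
have chainX := markov_chainP (joint p pi) (fun x => joint (trans M x.1 x.2) pi).
have := discounted_expectation_cvg chainX (ltW (discount_gt0 M)) (discount_lt1 M)
  (g := fun x => f x.1 x.2).
rewrite -/(trajectory M pi p) (_ : (fun t => _) = (fun t => gamma ^+ t *
  mean (state_marginal pi p t) (fun s => mean (pi s) (f s))))//.
apply/funext => t; congr (_ * _); rewrite /mean.
under [RHS]eq_bigr do rewrite mulr_sumr.
rewrite pair_bigA; apply: eq_bigr => -[s a] _.
by rewrite trajectory_marginal mulrA.
Qed.

Let partial f pi p n := series (fun t => gamma ^+ t *
  mean (state_marginal pi p t) (fun s => mean (pi s) (f s))) n.

Let partialE f pi p n : partial f pi p n = \sum_(0 <= t < n) gamma ^+ t *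
  mean (state_marginal pi p t) (fun s => mean (pi s) (f s)).
Proof. by []. Qed.

Let state_marginalS pi p t : state_marginal pi p t.+1 = state_step pi (state_marginal pi p t).
Proof. by []. Qed.

Lemma state_marginal_mean pi p t s' :
  state_marginal pi p t s' = \sum_s p s * state_marginal pi (ddirac R s) t s'.
Proof.
elim: t s' => [|t IH] s'.
  rewrite (bigD1 s')//= eqxx mulr1 big1 ?addr0// => s /negbTE.
  by rewrite eq_sym => ->; rewrite mulr0.
rewrite state_marginalS {1}/state_step.
under eq_bigr => s _.
  under eq_bigr => a _ do rewrite IH -mulrA mulr_suml.
  rewrite exchange_big; over.
rewrite exchange_big; apply: eq_bigr => s _; rewrite state_marginalS mulr_sumr.
apply: eq_bigr => s1 _; rewrite mulr_sumr; apply: eq_bigr => a _.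
by rewrite /= !mulrA.
Qed.

Let partial_mean f pi p n : partial f pi p n = \sum_s p s * partial f pi (ddirac R s) n.
Proof.
rewrite partialE; under [RHS]eq_bigr do rewrite partialE mulr_sumr.
rewrite exchange_big; apply: eq_bigr => t _.
transitivity (gamma ^+ t * \sum_s' \sum_s p s *
    (state_marginal pi (ddirac R s) t s' * mean (pi s') (f s'))).
  congr (_ * _); apply: eq_bigr => s' _; rewrite state_marginal_mean mulr_suml.
  by apply: eq_bigr => s _; rewrite mulrA.
rewrite exchange_big mulr_sumr; apply: eq_bigr => s _.
by rewrite -mulr_sumr mulrCA.
Qed.

Lemma expected_sum_mean f pi (p : dist R S) :
  expected_sum M f pi p = mean p (state_value M f pi).
Proof.
have c1 : partial f pi p @ \oo --> expected_sum M f pi p := @expected_sum_cvg _ _ _.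
have c2 : partial f pi p @ \oo --> mean p (state_value M f pi).
  rewrite (_ : partial f pi p = fun n => mean p (fun s => partial f pi (ddirac R s) n)).
    by apply: cvg_mean => s; exact: expected_sum_cvg.
  by apply/funext => n; exact: partial_mean.
exact: (cvg_unique _ c1 c2).
Qed.

Lemma valueE f pi : value M f pi = mean (init M) (state_value M f pi).
Proof. by []. Qed.

(** The first term of a partial sum is split off; the rest is a partial sum started from the law
    after one step, which is linear in that law. The limit of both sides gives the equation. *)
Lemma bellman f pi s :
  state_value M f pi s = mean (pi s) (action_value f (state_value M f pi) s).
Proof.
set v := state_value M f pi.
have E n : partial f pi (ddirac R s) n.+1 = mean (pi s) (f s) +
    gamma * mean (pi s) (fun a => mean (trans M s a) (fun s' => partial f pi (ddirac R s') n)).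
  rewrite partialE big_nat_recl// expr0 mul1r mean_ddirac; congr (_ + _).
  under eq_bigr => t _ do rewrite exprS -mulrA /state_marginal iterSr -/(state_marginal _ _ _).
  rewrite -mulr_sumr; congr (_ * _).
  transitivity (partial f pi (state_step pi (ddirac R s)) n); first by [].
  rewrite partial_mean; under [RHS]eq_bigr do rewrite mulr_sumr.
  rewrite exchange_big; apply: eq_bigr => s' _.
  rewrite {1}/state_step (bigD1 s)//= [X in _ + X]big1 ?addr0.
    by rewrite mulr_suml; apply: eq_bigr => a _; rewrite eqxx mul1r mulrA.
  by move=> s1 /negbTE s1s; rewrite big1// => a _; rewrite s1s !mul0r.
have c1 : partial f pi (ddirac R s) n.+1 @[n --> \oo] --> v s.
  by rewrite (@cvg_shiftS _ (partial f pi (ddirac R s))); exact: expected_sum_cvg.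
have c2 : partial f pi (ddirac R s) n.+1 @[n --> \oo] --> mean (pi s) (action_value f v s).
  rewrite (_ : mean _ _ = mean (pi s) (f s) +
    gamma * mean (pi s) (fun a => mean (trans M s a) v)); last first.
    by rewrite /action_value meanD meanZ.
  under eq_fun do rewrite E.
  apply: cvgD; first exact: cvg_cst.
  apply: cvgMl_tmp; apply: cvg_mean => a; apply: cvg_mean => s'.
  exact: expected_sum_cvg.
exact: (cvg_unique _ c1 c2).
Qed.

(* Evaluate the hypothesis at a state maximizing [u]. *)
Lemma contraction_le0 pi u :
  (forall s, u s <= gamma * mean (pi s) (fun a => mean (trans M s a) u)) ->
  forall s, u s <= 0.
Proof.
move=> Hu s0; pose s1 := [arg max_(s > s0) u s]%O.
have s1P s : u s <= u s1 by rewrite /s1; case: Order.TotalTheory.arg_maxP => // i _; exact.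
apply: le_trans (s1P s0) _.
have : u s1 <= gamma * u s1.
  apply: le_trans (Hu s1) _; rewrite ler_wpM2l ?(ltW (discount_gt0 M))//.
  rewrite -[leRHS](mean_cst (pi s1)); apply: ler_mean => a.
  by rewrite -[leRHS](mean_cst (trans M s1 a)); apply: ler_mean.
have := discount_lt1 M; rewrite -subr_le0 -{1}[u s1]mul1r -mulrBl -subr_gt0 => g1.
by rewrite pmulr_rle0.
Qed.

(** Comparison principle: the excess of the value over a supersolution satisfies the hypothesis of
    [contraction_le0]. Later inequalities between values come from a choice of [u]. *)
Lemma state_value_le f pi u :
  (forall s, mean (pi s) (action_value f u s) <= u s) ->
  forall s, state_value M f pi s <= u s.
Proof.
move=> Hu s; rewrite -subr_le0; move: s.
apply: (@contraction_le0 pi (fun s => state_value M f pi s - u s)) => s.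
rewrite bellman; apply: le_trans (lerB (lexx _) (Hu s)) _.
rewrite -[_ - mean _ _]addr0 le_eqVlt; apply/orP; left; apply/eqP.
rewrite addr0 /mean -sumrB mulr_sumr; apply: eq_bigr => a _.
rewrite /action_value -mulrBr opprD addrACA subrr add0r -mulrBr mulrCA.
by congr (_ * (_ * _)); rewrite /mean -sumrB; apply: eq_bigr => s' _; rewrite mulrBr.
Qed.

Lemma state_value_ge f pi u :
  (forall s, u s <= mean (pi s) (action_value f u s)) ->
  forall s, u s <= state_value M f pi s.
Proof.
move=> Hu s; rewrite -subr_le0; move: s.
apply: (@contraction_le0 pi (fun s => u s - state_value M f pi s)) => s.
rewrite bellman; apply: le_trans (lerB (Hu s) (lexx _)) _.
rewrite -[_ - mean _ _]addr0 le_eqVlt; apply/orP; left; apply/eqP.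
rewrite addr0 /mean -sumrB mulr_sumr; apply: eq_bigr => a _.
rewrite /action_value -mulrBr opprD addrACA subrr add0r -mulrBr mulrCA.
by congr (_ * (_ * _)); rewrite /mean -sumrB; apply: eq_bigr => s' _; rewrite mulrBr.
Qed.

Lemma state_value_unique f pi u :
  (forall s, u s = mean (pi s) (action_value f u s)) ->
  forall s, state_value M f pi s = u s.
Proof.
move=> Hu s; apply/eqP; rewrite eq_le; apply/andP; split.
  by apply: state_value_le => s'; rewrite -Hu.
by apply: state_value_ge => s'; rewrite -Hu.
Qed.

Lemma state_valueZD c f g pi s : state_value M (fun s a => c * f s a + g s a) pi s =
  c * state_value M f pi s + state_value M g pi s.
Proof.
apply: (state_value_unique (u := fun s => c * state_value M f pi s + state_value M g pi s)).
move=> {}s; rewrite [in LHS]bellman [in X in _ + X]bellman -meanZ -meanD.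
apply: eq_mean => a; rewrite /action_value meanD meanZ; ring.
Qed.

Lemma valueZD c f g pi : value M (fun s a => c * f s a + g s a) pi =
  c * value M f pi + value M g pi.
Proof. by rewrite !valueE -meanZ -meanD; apply: eq_mean => s; exact: state_valueZD. Qed.

Lemma ler_value f g pi : (forall s, mean (pi s) (f s) <= mean (pi s) (g s)) ->
  value M f pi <= value M g pi.
Proof.
move=> fg; apply: ler_mean; apply: state_value_le => s.
by rewrite [leRHS]bellman /action_value !meanD lerD2r.
Qed.

Lemma eq_value f g pi : (forall s, mean (pi s) (f s) = mean (pi s) (g s)) ->
  value M f pi = value M g pi.
Proof. by move=> fg; apply/eqP; rewrite eq_le !ler_value// => s; rewrite fg. Qed.

Lemma value_cst c pi : value M (fun _ _ => c) pi = c / (1 - gamma).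
Proof.
rewrite -[RHS](mean_cst (init M)); apply: eq_mean => s.
apply: (state_value_unique (u := fun=> c / (1 - gamma))) => {}s.
rewrite (eq_mean _ (g := fun=> c + gamma * (c / (1 - gamma)))) => [|a]; last first.
  by rewrite /action_value mean_cst.
rewrite mean_cst.
by field; have := discount_lt1 M; rewrite -subr_gt0 => /gt_eqF ->.
Qed.

Lemma value_sum (I : Type) (r : seq I) (F : I -> S -> A -> R) pi :
  value M (fun s a => \sum_(i <- r) F i s a) pi = \sum_(i <- r) value M (F i) pi.
Proof.
elim: r => [|i r IH].
  rewrite big_nil -[RHS](mul0r (1 - gamma)^-1) -(value_cst 0 pi).
  by apply: eq_value => s; apply: eq_mean => a; rewrite big_nil.
rewrite big_cons -IH -[value M (F i) pi]mul1r -valueZD; apply: eq_value => s.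
by apply: eq_mean => a; rewrite big_cons mul1r.
Qed.

(** An advantage of at most [b] per step sums to b / (1 - gamma): the state value of [pi] raised by
    this constant is a supersolution for [pi']. *)
Lemma value_performance_difference f pi pi' b :
  (forall s, mean (pi' s) (action_value f (state_value M f pi) s) -
             mean (pi s) (action_value f (state_value M f pi) s) <= b) ->
  value M f pi' - value M f pi <= b / (1 - gamma).
Proof.
move=> Hb; rewrite lerBlDl -[X in _ + X](mean_cst (init M)) valueE -meanD.
apply: ler_mean; apply: state_value_le => s.
have := Hb s; rewrite -bellman lerBlDl; set v := state_value M f pi.
rewrite /action_value !meanD !meanZ => H.
rewrite (eq_mean (pi' s) (f := fun a => mean _ (fun s' => v s' + _))
  (g := fun a => mean (trans M s a) v + b / (1 - gamma))) => [|a]; last first.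
  by rewrite meanD mean_cst.
rewrite meanD mean_cst; have := discount_lt1 M; rewrite -subr_gt0 => g1.
apply: (le_trans (y := (v s + b) + gamma * (b / (1 - gamma)))); first by lra.
by rewrite -addrA lerD2l le_eqVlt; apply/orP; left; apply/eqP; field; rewrite gt_eqF.
Qed.

End PolicyValues.

(** * Occupancies and the output policy *)

Section Mixture.
Context (R : realType) (alpha : R).
Implicit Types (f g : nat -> R) (T : nat).

Lemma mixture1 f : mixture 1 alpha f = f 1%N.
Proof. by rewrite /mixture subnn expr0 mul1r big_geq// addr0. Qed.

Lemma mixtureS T f : (0 < T)%N ->
  mixture T.+1 alpha f = (1 - alpha) * mixture T alpha f + alpha * f T.+1.
Proof.
case: T => // T _; rewrite /mixture big_nat_recr//= !subn1/= subnn expr0 mulr1.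
rewrite addrA mulrDr mulrA -exprS; congr (_ + _ + _).
rewrite mulr_sumr; apply: eq_big_nat => t /andP[_ tT].
by rewrite (subSn (m := t) tT) exprS; ring.
Qed.

Lemma mixtureZD T c f g : (0 < T)%N ->
  mixture T alpha (fun t => c * f t + g t) = c * mixture T alpha f + mixture T alpha g.
Proof.
case: T => // T _; elim: T => [|T IH]; first by rewrite !mixture1.
by rewrite !(@mixtureS T.+1 _ isT) IH; ring.
Qed.

Lemma eq_mixture T f g : (forall t, f t = g t) -> mixture T alpha f = mixture T alpha g.
Proof. by move=> /funext ->. Qed.

Lemma mixture_cst T c : (0 < T)%N -> mixture T alpha (fun=> c) = c.
Proof.
case: T => // T _; elim: T => [|T IH]; first by rewrite mixture1.
by rewrite mixtureS// IH; ring.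
Qed.

Lemma mixtureZ T c f : (0 < T)%N ->
  mixture T alpha (fun t => c * f t) = c * mixture T alpha f.
Proof.
case: T => // T _; elim: T => [|T IH]; first by rewrite !mixture1.
by rewrite !(@mixtureS T.+1 _ isT) IH; ring.
Qed.

Lemma mixture_sum (I : Type) (r : seq I) T (F : I -> nat -> R) : (0 < T)%N ->
  mixture T alpha (fun t => \sum_(i <- r) F i t) = \sum_(i <- r) mixture T alpha (F i).
Proof.
move=> T0; elim: r => [|i r IH].
  by rewrite big_nil -[RHS](mixture_cst 0 T0); apply: eq_mixture => t; rewrite big_nil.
rewrite big_cons -IH -[mixture T alpha (F i)]mul1r -mixtureZD//.
by apply: eq_mixture => t; rewrite big_cons mul1r.
Qed.

Lemma mixture_ge0 T f : (0 < T)%N -> 0 <= alpha <= 1 -> (forall t, 0 <= f t) ->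
  0 <= mixture T alpha f.
Proof.
case: T => // T _ /andP[a0 a1] f0; elim: T => [|T IH]; first by rewrite mixture1.
by rewrite mixtureS// addr_ge0 ?mulr_ge0// subr_ge0.
Qed.

End Mixture.

Section Occupancy.
Context (R : realType) (S A : finType) (m : nat) (M : cmdp R S A m).
Implicit Types (pi : policy R S A) (f : S -> A -> R) (u v : S -> R).

Local Notation gamma := (discount M).

Let indicator (s : S) (a : A) s' a' : R := ((s' == s) && (a' == a))%:R.

Let gamma1 : 1 - gamma != 0.
Proof. by have := discount_lt1 M; rewrite -subr_gt0 => /gt_eqF ->. Qed.

Lemma mean_init_expected_sum f pi : expected_sum M f pi (init M) = value M f pi.
Proof. exact: expected_sum_mean. Qed.

(** Seen as the value of an indicator reward, an occupancy inherits positivity and linearity from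
    [value]. *)
Lemma occupancyE pi s a : occupancy M pi s a = (1 - gamma) * value M (indicator s a) pi.
Proof.
rewrite /occupancy -mean_init_expected_sum; congr (_ * _); apply/cvg_lim => //.
rewrite (_ : (fun t => _) = (fun t => gamma ^+ t *
  mean (state_marginal M pi (init M) t) (fun s' => mean (pi s') (indicator s a s')))).
  exact: expected_sum_cvg.
apply/funext => t; congr (_ * _); rewrite -/(marginal _ _ _) trajectory_marginal.
rewrite /mean (bigD1 s)//= [X in _ + X]big1 ?addr0 => [|s' /negbTE s's].
  rewrite (bigD1 a)//= [X in _ + X]big1 ?addr0 => [|a' /negbTE a'a].
    by rewrite /indicator !eqxx mulr1.
  by rewrite /indicator a'a andbF mulr0.
by rewrite big1 ?mulr0// => a' _; rewrite /indicator s's mulr0.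
Qed.

Lemma value_occupancy f pi :
  (1 - gamma) * value M f pi = \sum_s \sum_a occupancy M pi s a * f s a.
Proof.
have -> : value M f pi =
    value M (fun s' a' => \sum_(x : S * A) (f x.1 x.2 * indicator x.1 x.2 s' a' + 0)) pi.
  apply: eq_value => s; apply: eq_mean => a.
  rewrite (bigD1 (s, a))//= /indicator !eqxx mulr1 addr0 big1 ?addr0// => -[s' a'].
  by rewrite xpair_eqE /= => /negbTE; rewrite ![s == _]eq_sym ![a == _]eq_sym => ->;
    rewrite mulr0 addr0.
rewrite value_sum mulr_sumr pair_bigA; apply: eq_bigr => -[s a] _ /=.
by rewrite valueZD value_cst mul0r addr0 occupancyE; ring.
Qed.

Lemma value_ge0 f pi : (forall s a, 0 <= f s a) -> 0 <= value M f pi.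
Proof.
move=> f0; rewrite -[leLHS](mul0r (1 - gamma)^-1) -(value_cst M 0 pi).
by apply: ler_value => s; apply: ler_mean.
Qed.

Lemma occupancy_ge0 pi s a : 0 <= occupancy M pi s a.
Proof.
rewrite occupancyE mulr_ge0 ?subr_ge0 ?(ltW (discount_lt1 M))//.
by apply: value_ge0 => s' a'; exact: ler0n.
Qed.

Lemma occupancy_flow u pi :
  \sum_s state_occupancy M pi s * u s =
  (1 - gamma) * mean (init M) u +
  gamma * \sum_s \sum_a occupancy M pi s a * mean (trans M s a) u.
Proof.
(* The telescoping reward: under every policy its state value is [u]. *)
pose f s a := u s - gamma * mean (trans M s a) u.
have <- : value M f pi = mean (init M) u.
  apply: eq_mean => s; apply: state_value_unique => {}s.
  rewrite (eq_mean _ (g := fun=> u s)) ?mean_cst// => a.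
  by rewrite /action_value /f subrK.
rewrite value_occupancy mulr_sumr -big_split; apply: eq_bigr => s _ /=.
rewrite mulr_sumr -big_split /= /state_occupancy mulr_suml.
by apply: eq_bigr => a _; rewrite /f; ring.
Qed.

(* The mixture of occupancies satisfies the flow equation; testing that equation against the
   state value of [pit] turns it into an identity of values. *)
Lemma output_value T (alpha : R) (pi : nat -> policy R S A) (pit : policy R S A) f :
  (0 < T)%N -> 0 <= alpha <= 1 -> is_output M T alpha pi pit ->
  value M f pit = mixture T alpha (fun t => value M f (pi t)).
Proof.
move=> T0 a01 out.
pose nu s a := mixture T alpha (fun t => occupancy M (pi t) s a).
pose chi s := mixture T alpha (fun t => state_occupancy M (pi t) s).
have chiE s : chi s = \sum_a nu s a.
  by rewrite /chi /nu -mixture_sum.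
have nu_ge0 s a : 0 <= nu s a.
  by apply: mixture_ge0 => // t; exact: occupancy_ge0.
have nuE s a : nu s a = chi s * pit s a.
  (* Where [chi] vanishes, [nu] is a family of nonnegative terms with sum 0, so the arbitrary choice
     of [pit] there is harmless. *)
  have [chi0|chi0] := eqVneq (chi s) 0; last first.
    by rewrite out// mulrCA divff// mulr1.
  rewrite chi0 mul0r; apply/eqP; move: (chi0); rewrite chiE => /eqP.
  by rewrite psumr_eq0// => /allP /(_ a); rewrite mem_index_enum => /(_ isT).
set v := state_value M f pit.
have flow : \sum_s chi s * v s = (1 - gamma) * mean (init M) v +
    gamma * \sum_s \sum_a nu s a * mean (trans M s a) v.
  transitivity (mixture T alpha (fun t => \sum_s state_occupancy M (pi t) s * v s)).
    rewrite mixture_sum//; apply: eq_bigr => s _.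
    by rewrite mulrC -mixtureZ//; apply: eq_mixture => t; rewrite mulrC.
  rewrite (eq_mixture _ _ (g := fun t => gamma *
    (\sum_s \sum_a occupancy M (pi t) s a * mean (trans M s a) v) + (1 - gamma) * mean (init M) v)).
    rewrite mixtureZD// mixture_cst// addrC mixture_sum//; congr (_ + _ * _).
    apply: eq_bigr => s _; rewrite mixture_sum//; apply: eq_bigr => a _.
    by rewrite mulrC -mixtureZ//; apply: eq_mixture => t; rewrite mulrC.
  by move=> t; rewrite occupancy_flow addrC.
have chiv : \sum_s chi s * v s =
    \sum_s \sum_a nu s a * f s a + gamma * \sum_s \sum_a nu s a * mean (trans M s a) v.
  rewrite mulr_sumr -big_split; apply: eq_bigr => s _ /=.
  rewrite mulr_sumr -big_split /v bellman /mean mulr_sumr.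
  by apply: eq_bigr => a _; rewrite nuE /action_value /= -/v /mean; ring.
apply: (mulfI gamma1); rewrite [in LHS]valueE -/v.
have -> : (1 - gamma) * mean (init M) v = \sum_s \sum_a nu s a * f s a.
  by move: flow; rewrite chiv addrC [RHS]addrC => /addrI.
rewrite -mixtureZ//; under [RHS]eq_mixture do rewrite value_occupancy.
rewrite mixture_sum//; apply: eq_bigr => s _; rewrite mixture_sum//.
apply: eq_bigr => a _; rewrite mulrC -mixtureZ//.
by apply: eq_mixture => t; rewrite mulrC.
Qed.

End Occupancy.

(** * Softmax and total variation *)

Section DotProduct.
Context (R : realType) (m : nat).
Implicit Types (u v w : 'rV[R]_m) (c : R).

Lemma dotC u v : dot u v = dot v u.
Proof. by apply: eq_bigr => i _; rewrite mulrC. Qed.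

Lemma dotDr u v w : dot u (v + w) = dot u v + dot u w.
Proof. by rewrite /dot -big_split; apply: eq_bigr => i _; rewrite mxE mulrDr. Qed.

Lemma dotZr u c v : dot u (c *: v) = c * dot u v.
Proof. by rewrite /dot mulr_sumr; apply: eq_bigr => i _; rewrite mxE mulrCA. Qed.

Lemma dotNr u v : dot u (- v) = - dot u v.
Proof. by rewrite -scaleN1r dotZr mulN1r. Qed.

Lemma dotBr u v w : dot u (v - w) = dot u v - dot u w.
Proof. by rewrite dotDr dotNr. Qed.

Lemma dotDl u v w : dot (u + v) w = dot u w + dot v w.
Proof. by rewrite ![dot _ w]dotC dotDr. Qed.

Lemma dotZl u c v : dot (c *: u) v = c * dot u v.
Proof. by rewrite ![dot _ v]dotC dotZr. Qed.

Lemma dotNl u v : dot (- u) v = - dot u v.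
Proof. by rewrite ![dot _ v]dotC dotNr. Qed.

Lemma dot0l v : dot 0 v = 0.
Proof. by rewrite -(scale0r 0) dotZl mul0r. Qed.

Definition dotE := (dotDl, dotDr, dotZl, dotZr, dotNl, dotNr).

Lemma norm2_sqr u : norm2 u ^+ 2 = dot u u.
Proof.
rewrite sqr_sqrtr; first by apply: eq_bigr => i _; rewrite expr2.
by apply: sumr_ge0 => i _; exact: sqr_ge0.
Qed.

Lemma dot_ge0 u : 0 <= dot u u.
Proof. by rewrite -norm2_sqr sqr_ge0. Qed.

Lemma dot_norm2 u v : dot u v <= norm2 u * norm2 v.
Proof.
have n0 w : 0 <= norm2 w by exact: sqrtr_ge0.
rewrite (le_trans (ler_norm _))// -(ler_pXn2r (n := 2))// ?nnegrE ?mulr_ge0//.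
rewrite real_normK ?num_real// exprMn !norm2_sqr.
have := dot_ge0 (dot v v *: u - dot u v *: v).
rewrite !dotE [dot v u]dotC => h.
have [v0|v0] := eqVneq (dot v v) 0.
  have {}v0 i : v 0 i = 0.
    move: v0 => /eqP; rewrite psumr_eq0 => [/allP/(_ i)|j _]; last by rewrite -expr2 sqr_ge0.
    by rewrite mem_index_enum => /(_ isT)/=; rewrite mulf_eq0 orbb => /eqP.
  have -> : dot u v = 0 by rewrite /dot big1// => i _; rewrite v0 mulr0.
  by rewrite expr0n/= mulr_ge0 ?dot_ge0.
have {}v0 : 0 < dot v v by rewrite lt_neqAle eq_sym v0 dot_ge0.
rewrite -(ler_pM2l v0) -subr_ge0; move: h; rewrite [X in 0 <= X -> _](_ : _ = dot v v *
  (dot u u * dot v v) - dot v v * (dot u v) ^+ 2)//; ring.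
Qed.

End DotProduct.

Section Softmax.
Context (R : realType) (A : finType) (A0 : (0 < #|A|)%N).
Implicit Types (p q : dist R A) (x y f : A -> R).

Lemma dist_le1 p a : p a <= 1.
Proof.
rewrite -(dist_sum1 p) (bigD1 a)//= lerDl sumr_ge0// => b _; exact: dist_ge0.
Qed.

(** Gibbs variational principle, from ln z <= z - 1 at z = exp (x a) / (Z p a); an action with p a =
    0 contributes 0 on the left. *)
Lemma gibbs p x : mean p (fun a => x a - ln (p a)) <= ln (\sum_a expR (x a)).
Proof.
have Z0 := softmax_gt0 A0 x; set Z := \sum_a _ in Z0 *.
rewrite -subr_le0 -[X in _ - X](mean_cst p) /mean -sumrB.
apply: (le_trans (y := \sum_a (expR (x a) / Z - p a))); last first.
  by rewrite sumrB dist_sum1 -mulr_suml divff ?subrr ?gt_eqF.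
apply: ler_sum => a _; have [pa0|pa] := eqVneq (p a) 0.
  by rewrite pa0 !mul0r !subr0 divr_ge0 ?expR_ge0// ltW.
have {}pa : 0 < p a by rewrite lt_neqAle eq_sym pa dist_ge0.
rewrite -mulrBr -ler_pdivlMl// mulrBr mulVf ?gt_eqF//.
have -> : x a - ln (p a) - ln Z = ln (1 + ((p a)^-1 * (expR (x a) / Z) - 1)).
  rewrite [1 + _]addrC subrK lnM ?posrE ?invr_gt0 ?divr_gt0 ?expR_gt0//.
  by rewrite lnM ?posrE ?invr_gt0 ?expR_gt0// !lnV ?posrE// expRK; ring.
apply: le_ln1Dx; rewrite -subr_gt0 opprK subrK.
by rewrite mulr_gt0 ?divr_gt0 ?invr_gt0 ?expR_gt0.
Qed.

Lemma gibbs_softmax x :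
  mean (softmax A0 x) (fun a => x a - ln (softmax A0 x a)) = ln (\sum_a expR (x a)).
Proof.
rewrite -[RHS](mean_cst (softmax A0 x)); apply: eq_mean => a /=.
have Z0 := softmax_gt0 A0 x.
by rewrite lnM ?posrE ?invr_gt0 ?expR_gt0// lnV ?posrE// expRK; ring.
Qed.

(** Equal masses allow [f] to be centred at the middle of a range of length [d], where it is at most
    d / 2 in absolute value; this matches the 1/2 in [dTV]. *)
Lemma mean_dTV (p q : A -> R) f d : \sum_a p a = \sum_a q a ->
  (forall a a', f a - f a' <= d) -> mean p f - mean q f <= dTV p q * d.
Proof.
move=> pq fd; have [a1 _] := card_gt0P A0.
pose a0 := [arg min_(a < a1) f a]%O.
have a0P a : f a0 <= f a by rewrite /a0; case: Order.TotalTheory.arg_minP => // i _; exact.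
have -> : mean p f - mean q f = \sum_a (p a - q a) * (f a - (f a0 + d / 2)).
  rewrite [RHS](eq_bigr (fun a => (p a * f a - q a * f a) - (p a - q a) * (f a0 + d / 2))).
    by rewrite !sumrB -mulr_suml sumrB pq subrr mul0r subr0.
  by move=> a _; ring.
rewrite /dTV [leRHS]mulrAC mulr_sumr; apply: ler_sum => a _.
rewrite (le_trans (ler_norm _))// normrM mulrC ler_wpM2r//.
have h1 := a0P a; have h2 := fd a a0.
by rewrite ler_norml; apply/andP; split; lra.
Qed.

(* With P, Q the masses that the two laws give to the set where the first one is larger, the
   odds satisfy P (1 - Q) <= exp (hi - lo) Q (1 - P); the constant 1/2, rather than 1, is what
   makes the smoothness constant fit under Ld. *)
Lemma dTV_softmax x y lo hi : (forall a, lo <= x a - y a <= hi) ->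
  dTV (softmax A0 x) (softmax A0 y) <= (hi - lo) / 2.
Proof.
move=> xy; set p := softmax A0 x; set q := softmax A0 y.
have dp0 a : 0 <= p a by exact: dist_ge0.
have dq0 a : 0 <= q a by exact: dist_ge0.
pose P := \sum_(a | q a < p a) p a; pose Q := \sum_(a | q a < p a) q a.
pose P' := \sum_(a | ~~ (q a < p a)) p a; pose Q' := \sum_(a | ~~ (q a < p a)) q a.
have PP : P + P' = 1 by rewrite -(dist_sum1 p) [RHS](bigID (fun a => q a < p a)).
have QQ : Q + Q' = 1 by rewrite -(dist_sum1 q) [RHS](bigID (fun a => q a < p a)).
have tvE : dTV p q = P - Q.
  rewrite /dTV (bigID (fun a => q a < p a))/=.
  have -> : \sum_(a | q a < p a) `|p a - q a| = P - Q.
    by rewrite -sumrB; apply: eq_bigr => a h; rewrite gtr0_norm ?subr_gt0.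
  have -> : \sum_(a | ~~ (q a < p a)) `|p a - q a| = Q' - P'.
    rewrite -sumrB; apply: eq_bigr => a; rewrite -leNgt => h.
    by rewrite ler0_norm ?subr_le0// opprB.
  lra.
have PQ : Q <= P by apply: ler_sum => a /ltW.
have Q0 : 0 <= Q by apply: sumr_ge0.
have P'0 : 0 <= P' by apply: sumr_ge0.
have odds a b : expR (lo - hi) * (p a * q b) <= q a * p b.
  rewrite /p /q /=.
  have Zx := softmax_gt0 A0 x; have Zy := softmax_gt0 A0 y.
  set X := \sum_c _ in Zx *; set Y := \sum_c _ in Zy *.
  have -> : expR (lo - hi) * (expR (x a) / X * (expR (y b) / Y)) =
    expR (lo - hi + x a + y b) / (X * Y) by rewrite !expRD invfM; ring.
  have -> : expR (y a) / Y * (expR (x b) / X) = expR (y a + x b) / (X * Y).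
    by rewrite !expRD invfM; ring.
  rewrite ler_pM2r ?invr_gt0 ?mulr_gt0// ler_expR.
  by have /andP[_ h1] := xy a; have /andP[h2 _] := xy b; lra.
have oddsPQ : expR (lo - hi) * (P * Q') <= Q * P'.
  rewrite /P /Q mulr_suml mulr_sumr [leRHS]mulr_suml; apply: ler_sum => a _.
  by rewrite /P' /Q' !mulr_sumr; apply: ler_sum => b _; exact: odds.
(* If t = P - Q exceeded (hi - lo) / 2, then E = exp ((lo - hi) / 2) would exceed 1 - t. With z = P
   (1 - Q) the odds inequality reads E^2 z <= z - t, hence 1 < (2 - t) z, against 4 z <= (1 +
   t)^2. *)
rewrite tvE leNgt; apply/negP => tw.
have E0 : 0 < expR ((lo - hi) / 2) by exact: expR_gt0.
have E1 : 1 + (lo - hi) / 2 <= expR ((lo - hi) / 2) by exact: expR_ge1Dx.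
have EE : expR (lo - hi) = expR ((lo - hi) / 2) * expR ((lo - hi) / 2).
  by rewrite -expRD; congr expR; field.
rewrite EE in oddsPQ; move: (expR _) E0 E1 oddsPQ => E E0 E1 oddsPQ.
have P'E : P' = 1 - P by rewrite -PP; ring.
have Q'E : Q' = 1 - Q by rewrite -QQ; ring.
rewrite {}P'E {PP} in P'0 oddsPQ; rewrite {}Q'E {QQ} in oddsPQ.
have w0 : lo <= hi by have [a _] := card_gt0P A0; have /andP[h1 h2] := xy a; lra.
pose t := P - Q; have t0 : 0 < t by rewrite /t; lra.
have t1 : 0 <= 1 - t by rewrite /t; lra.
have Et : 1 - t < E by rewrite /t; lra.
have Et2 : (1 - t) * (1 - t) < E * E by nra.
pose z := P * (1 - Q).
have zt : Q * (1 - P) = z - t by rewrite /z /t; ring.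
have z4 : 4 * z <= (1 + t) * (1 + t).
  by have := sqr_ge0 (P - (1 - Q)); rewrite /z /t expr2; lra.
rewrite zt -/z in oddsPQ.
have z0 : 0 < z by have := mulr_ge0 Q0 P'0; rewrite zt; lra.
have : (1 - t) * (1 - t) * z < E * E * z by rewrite ltr_pM2r.
(* The factored form of 4 - (2 - t) (1 + t)^2. *)
have h3 : 0 <= (1 - t) * (1 - t) * (2 + t) by rewrite !mulr_ge0//; lra.
move=> h4; have : t * 1 < t * ((2 - t) * z) by lra.
rewrite ltr_pM2l// => h5.
have : (2 - t) * (4 * z) <= (2 - t) * ((1 + t) * (1 + t)) by rewrite ler_wpM2l//; lra.
lra.
Qed.

End Softmax.

(** * Mixing time *)

Section MixingConstant.
Context (R : realType).
Implicit Types (C beta : R).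

(** The first [N] terms are bounded by 1 and the others by the geometric series; in the induction,
    removing a term replaces [C] by C beta. *)
Lemma min_geometric_sum C beta n N : 0 < C -> 0 < beta -> beta < 1 ->
  \sum_(0 <= t < n) Num.min 1 (2 * C * beta ^+ t) <=
  N%:R + 2 * C * beta ^+ N / (1 - beta).
Proof.
move=> C0 b0 b1; have b1' : 0 < 1 - beta by rewrite subr_gt0.
elim: N n C C0 => [|N IH] n C C0.
  rewrite add0r expr0 mulr1.
  apply: le_trans (_ : \sum_(0 <= t < n) 2 * C * beta ^+ t <= _).
    by apply: ler_sum => t _; rewrite ge_min lexx orbT.
  rewrite -[leLHS]/(series (geometric (2 * C) beta) n).
  by apply: geometric_le_lim => //; rewrite ?gtr0_norm// mulr_ge0// ltW.
case: n => [|n].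
  by rewrite big_geq// addr_ge0// divr_ge0 ?(ltW b1')// !mulr_ge0 ?exprn_ge0 ?(ltW C0) ?(ltW b0).
have -> : N.+1%:R + 2 * C * beta ^+ N.+1 / (1 - beta) =
    1 + (N%:R + 2 * (C * beta) * beta ^+ N / (1 - beta)).
  by rewrite -natr1 exprS; field; rewrite gt_eqF.
rewrite big_nat_recl//; apply: lerD; first by rewrite ge_min lexx.
apply: le_trans (IH n _ (mulr_gt0 C0 b0)); apply: ler_sum => t _.
by rewrite exprS !mulrA.
Qed.

(* exp 0.72 = (exp 0.045) ^ 16 >= 1.045 ^ 16 *)
Lemma expR_72_gt2 : 2 < expR (72 / 100 : R).
Proof.
have -> : (72 / 100 : R) = 45 / 1000 + 45 / 1000 + (45 / 1000 + 45 / 1000) +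
  (45 / 1000 + 45 / 1000 + (45 / 1000 + 45 / 1000)) +
  (45 / 1000 + 45 / 1000 + (45 / 1000 + 45 / 1000) +
  (45 / 1000 + 45 / 1000 + (45 / 1000 + 45 / 1000))) by lra.
rewrite !expRD; have : 1 + 45 / 1000 <= expR (45 / 1000 : R) by exact: expR_ge1Dx.
move: (expR _) => e e1.
have e2 : 1092 / 1000 <= e * e by nra.
move: (e * e) e2 => f f2; have f4 : 1192 / 1000 <= f * f by nra.
move: (f * f) f4 => g g2; have g4 : 142 / 100 <= g * g by nra.
move: (g * g) g4 => h h2; nra.
Qed.

(** With C = exp (- u) and (1 + u/2)^2 <= exp u, it suffices that 1 <= 2 (1 - u) (1 + u/2)^2. This
    fails at u = 1, hence the need for a numerical bound on u, here 0.72, just above ln 2. *)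
Lemma le_two_ln C : 2^-1 <= C -> C <= 1 -> C <= 2 * (1 - ln C^-1).
Proof.
move=> C2 C1; have C0 : 0 < C by lra.
set u := ln C^-1.
have u0 : 0 <= u by rewrite ln_ge0// invf_ge1.
have eu : expR u = C^-1 by rewrite lnK// posrE invr_gt0.
have u72 : u <= 72 / 100.
  rewrite leNgt; apply/negP => /ltW; rewrite -ler_expR eu => h.
  have := lt_le_trans expR_72_gt2 h; rewrite -[X in X < _]invrK ltf_pV2 ?posrE ?invr_gt0//.
  lra.
have eu2 : (1 + u / 2) * (1 + u / 2) <= C^-1.
  rewrite -eu; have -> : expR u = expR (u / 2) * expR (u / 2).
    by rewrite -expRD; congr expR; lra.
  by apply: ler_pM; rewrite ?expR_ge1Dx//; lra.
have Cu : C * ((1 + u / 2) * (1 + u / 2)) <= 1.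
  by rewrite -(ler_pM2l C0) divff ?gt_eqF// in eu2.
have q0 : 0 < (1 + u / 2) * (1 + u / 2) by rewrite mulr_gt0//; lra.
rewrite -(ler_pM2r q0); apply: le_trans Cu _.
clear - u0 u72.
nra.
Qed.

(* For C < 1 the ceiling in [L_nu] is nonpositive and must be absorbed by the geometric sum. *)
Lemma min_geometric_sum_L_nu C beta n : 2^-1 <= C -> 0 < beta -> beta < 1 ->
  \sum_(0 <= t < n) Num.min 1 (2 * C * beta ^+ t) <= 4 * L_nu C beta - 1.
Proof.
move=> C2 b0 b1; have C0 : 0 < C by lra.
have x0 : 0 < (1 - beta)^-1 by rewrite invr_gt0 subr_gt0.
have lnb : ln beta < 0 by rewrite ln_lt0// b0.
have c1 := ceil_ge (ln C^-1 / ln beta).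
rewrite /L_nu; have [C1|C1] := leP 1 C.
  have r0 : 0 <= ln C^-1 / ln beta.
    by rewrite mulr_le0// ?invr_le0 ?(ltW lnb)// ln_le0// invf_le1.
  have : 0 <= Num.ceil (ln C^-1 / ln beta) by rewrite ceil_ge0; lra.
  (* [N] is the first part of [L_nu], and C beta^N <= 1: cutting the sum at [N] leaves a tail of at
     most 2 / (1 - beta). *)
  case: (Num.ceil _) c1 => [N|//] c1 _; rewrite -pmulrn in c1 *.
  apply: le_trans (min_geometric_sum n N C0 b0 b1) _.
  have : C * beta ^+ N <= 1.
    rewrite -ler_ln ?posrE ?mulr_gt0 ?exprn_gt0// ln1 lnM ?posrE ?exprn_gt0// lnXn//.
    move: c1; rewrite ler_ndivrMr// lnV ?posrE// => c1.
    by rewrite -mulr_natl; lra.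
  move=> CN; have : 2 * C * beta ^+ N / (1 - beta) <= 2 * (1 - beta)^-1.
    by rewrite ler_pM2r// -mulrA ger_pMr.
  have := ler0n R N; lra.
(* Nothing is cut off here. With u = ln C^-1 and x = 1 / (1 - beta), the ceiling is at least - u x,
   so L_nu >= (1 - u) x + 1, while [le_two_ln] gives 2 C x <= 4 (1 - u) x. *)
apply: le_trans (min_geometric_sum n 0 C0 b0 b1) _.
rewrite add0r expr0 mulr1.
have u0 : 0 <= ln C^-1 by rewrite ln_ge0// invf_ge1// ltW.
have cu := le_two_ln C2 (ltW C1).
have lnbb : ln beta <= beta - 1.
  have := @le_ln1Dx R (beta - 1); rewrite addrCA subrr addr0; apply.
  by rewrite ltrBrDl subrr.
have h : - (1 - beta)^-1 <= (ln beta)^-1.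
  by rewrite -invrN lef_nV2 ?negrE//; lra.
have := ler_wpM2l u0 h; have := ler_wpM2r (ltW x0) cu.
lra.
Qed.

End MixingConstant.

Section TotalVariation.
Context (R : realType) (T : finType).
Implicit Types p q r : T -> R.

Lemma dTV_sym p q : dTV p q = dTV q p.
Proof. by congr (_ * _); apply: eq_bigr => x _; rewrite distrC. Qed.

Lemma dTV_triangle r p q : dTV p q <= dTV p r + dTV r q.
Proof.
rewrite /dTV -mulrDr ler_pM2l ?invr_gt0// -big_split /=.
by apply: ler_sum => x _; rewrite ler_distD.
Qed.

Lemma dTV_ge0 p q : 0 <= dTV p q.
Proof. by rewrite mulr_ge0 ?invr_ge0// sumr_ge0. Qed.

Lemma dTV_le1 p q : (forall x, 0 <= p x) -> (forall x, 0 <= q x) ->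
  \sum_x p x = 1 -> \sum_x q x = 1 -> dTV p q <= 1.
Proof.
move=> p0 q0 p1 q1; rewrite /dTV ler_pdivrMl// mulr1.
apply: le_trans (_ : \sum_x (p x + q x) <= _); last by rewrite big_split/= p1 q1.
apply: ler_sum => x _; have := p0 x; have := q0 x.
by rewrite ler_norml => h1 h2; apply/andP; split; lra.
Qed.

End TotalVariation.

(** * Span of state values under mixing *)

Section ErgodicSpan.
Context (R : realType) (S A : finType) (m : nat) (M : cmdp R S A m).
Implicit Types (pi : policy R S A).

Local Notation gamma := (discount M).

Lemma state_lawE pi s t s' : state_law M pi s t s' = state_marginal M pi (ddirac R s) t s'.
Proof.
have [mX _] := markov_chainP (joint (ddirac R s) pi) (fun x => joint (trans M x.1 x.2) pi).
rewrite -[RHS]mulr1 -(dist_sum1 (pi s')) mulr_sumr.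
under eq_bigr do rewrite -trajectory_marginal.
have E a : [set u | (trajectory M pi (ddirac R s) t u).1 = s'] `&`
    [set u | (trajectory M pi (ddirac R s) t u).2 = a] =
    [set u | trajectory M pi (ddirac R s) t u = (s', a)].
  apply/seteqP; split=> u /=; first by case: (trajectory _ _ _ _ _) => ? ? /= [-> ->].
  by move=> ->.
rewrite /state_law (@chain_total_prob R A (fun u => (trajectory M pi (ddirac R s) t u).2)).
  transitivity (fine (\sum_a (marginal (trajectory M pi (ddirac R s)) t (s', a))%:E)%E).
    congr fine; apply: eq_bigr => a _.
    rewrite E /marginal fineK//; apply: fin_num_measure; exact: mX.
  by rewrite sumEFin.
by move=> a; rewrite E; exact: mX.
Qed.

Lemma state_marginal_ge0 pi s t s' : 0 <= state_marginal M pi (ddirac R s) t s'.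
Proof.
elim: t s' => [|t IH] s' /=; first exact: ler0n.
by rewrite /state_step !sumr_ge0// => s1 _; rewrite sumr_ge0// => a _; rewrite !mulr_ge0 ?dist_ge0.
Qed.

Lemma state_marginal_sum1 pi s t : \sum_s' state_marginal M pi (ddirac R s) t s' = 1.
Proof.
elim: t => [|t IH]; first exact: dist_sum1.
rewrite -[RHS]IH [LHS]exchange_big; apply: eq_bigr => s1 _ /=.
rewrite exchange_big; under eq_bigr do rewrite -mulr_sumr dist_sum1 mulr1.
by rewrite -mulr_sumr dist_sum1 mulr1.
Qed.

(** The chains started at [s] and [s'] are both within CM beta^t of [chi], so their laws differ by
    at most min (1, 2 CM beta^t); the rewards collected at time t then differ by at most that times
    [c]. *)
Lemma state_value_span_ergodic (tau B CM beta : R) lam : box B lam ->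
  uniformly_ergodic M tau B CM beta -> 1 <= L_nu CM beta ->
  forall h c, (forall s a s' a', h s a - h s' a' <= c) ->
  forall s s', state_value M h (soft_policy M tau lam) s -
    state_value M h (soft_policy M tau lam) s' <= (4 * L_nu CM beta - 1) * c.
Proof.
move=> lamB [CM0 b0 b1 /(_ lam lamB)[chi _ erg]] L1 h c hc s s'.
set pi := soft_policy M tau lam in erg *.
have [a0 _] := card_gt0P (action_gt0 M).
have c0 : 0 <= c by have := hc s a0 s a0; rewrite subrr.
have k0 : 0 <= 4 * L_nu CM beta - 1 by lra.
(* Two distinct states are what yields CM >= 1/2 below. *)
have [->|ss'] := eqVneq s s'; first by rewrite subrr mulr_ge0.
have ergt s1 t : dTV (state_marginal M pi (ddirac R s1) t) chi <= CM * beta ^+ t.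
  apply: le_trans (erg t); rewrite (_ : state_marginal _ _ _ _ = state_law M pi s1 t).
    exact: (le_bigmax _ (fun s => dTV (state_law M pi s t) chi)).
  by apply/funext => s2; rewrite state_lawE.
pose q t := dTV (state_marginal M pi (ddirac R s) t) (state_marginal M pi (ddirac R s') t).
have q2 t : q t <= 2 * CM * beta ^+ t.
  apply: le_trans (dTV_triangle chi _ _) _; rewrite [X in _ + X]dTV_sym.
  by have := ergt s t; have := ergt s' t; lra.
have q1 t : q t <= 1.
  by apply: dTV_le1; [exact: state_marginal_ge0|exact: state_marginal_ge0|
    exact: state_marginal_sum1|exact: state_marginal_sum1].
(* Two distinct Dirac masses are at distance 1, and each is within CM of chi. *)
have CM2 : 2^-1 <= CM.
  have := q2 0%N; rewrite expr0 mulr1 /q /dTV /state_marginal /=.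
  rewrite (bigD1 s)//= (bigD1 s')//= 1?eq_sym// !eqxx ![s' == s]eq_sym (negbTE ss').
  rewrite subr0 sub0r normrN normr1.
  have : 0 <= \sum_(i | (i != s) && (i != s')) `|(i == s)%:R - (i == s')%:R| :> R.
    by rewrite sumr_ge0.
  by lra.
have S0 : (0 < #|S|)%N by apply/card_gt0P; exists s.
pose partial s1 := series (fun t => gamma ^+ t *
  mean (state_marginal M pi (ddirac R s1) t) (fun s => mean (pi s) (h s))).
have cvgD : (fun n => partial s n - partial s' n) @ \oo -->
    state_value M h pi s - state_value M h pi s'.
  by apply: cvgB; exact: expected_sum_cvg.
rewrite -(cvg_lim (@Rhausdorff R) cvgD).
apply: limr_le; first by apply/cvg_ex; eexists; exact: cvgD.
apply: nearW => n; rewrite /partial /series /= -sumrB.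
apply: (le_trans (y := \sum_(0 <= t < n) Num.min 1 (2 * CM * beta ^+ t) * c)); last first.
  by rewrite -mulr_suml ler_wpM2r//; exact: min_geometric_sum_L_nu.
apply: ler_sum => t _; rewrite -mulrBr.
have mh s1 s2 : mean (pi s1) (h s1) - mean (pi s2) (h s2) <= c.
  rewrite lerBlDl -[leLHS](mean_cst (pi s2)) -[X in _ + X](mean_cst (pi s2)) -meanD.
  apply: ler_mean => a; rewrite -[leRHS](mean_cst (pi s1)); apply: ler_mean => a'.
  by have := hc s1 a' s2 a; lra.
apply: (le_trans (y := gamma ^+ t * (q t * c))).
  rewrite ler_wpM2l ?exprn_ge0 ?(ltW (discount_gt0 M))//.
  by apply: mean_dTV => //; rewrite !state_marginal_sum1.
(* The discount is bounded by 1: mixing alone makes the sum converge, without a factor 1 / (1 -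
   gamma). *)
apply: (le_trans (y := q t * c)).
  apply: ler_piMl; first by apply: mulr_ge0 => //; exact: dTV_ge0.
  by apply: exprn_ile1; apply/ltW; [exact: discount_gt0|exact: discount_lt1].
by rewrite ler_wpM2r// le_min q1 q2.
Qed.

End ErgodicSpan.

(** * The entropy-regularized dual *)

Section RegularizedMDP.
Context (R : realType) (S A : finType) (m : nat) (M : cmdp R S A m) (tau : R)
  (tau0 : 0 < tau).
Implicit Types (pi : policy R S A) (lam : 'rV[R]_m) (f : S -> A -> R).

Local Notation gamma := (discount M).
Local Notation soft := (soft_policy M tau).

Let gamma0 : 0 < gamma := discount_gt0 M.
Let dgamma : 0 < 1 - gamma.
Proof. by rewrite subr_gt0 discount_lt1. Qed.

Let dgamma0 : 1 - gamma != 0.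
Proof. by rewrite gt_eqF. Qed.

Let taun0 : tau != 0.
Proof. by rewrite gt_eqF. Qed.

Definition soft_value lam s : R := tau * ln (\sum_a expR (soft_Q M tau lam s a / tau)).

(** The entropy bonus is put into a reward that depends on the policy, so that the results on plain
    values apply to the regularized problem. *)
Definition entropy_reward lam pi s a : R := lagr_reward M lam s a - tau * ln (pi s a).

Lemma soft_QE lam s a :
  soft_Q M tau lam s a = action_value M (lagr_reward M lam) (soft_value lam) s a.
Proof. by have [-> _] := soft_QP M lam tau0. Qed.

Let entropy_action_value lam pi s :
  mean (pi s) (action_value M (entropy_reward lam pi) (soft_value lam) s) =
  tau * mean (pi s) (fun a => soft_Q M tau lam s a / tau - ln (pi s a)).
Proof.
rewrite -meanZ; apply: eq_mean => a.
by rewrite mulrBr mulrCA divff ?gt_eqF// mulr1 soft_QE /action_value /entropy_reward; ring.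
Qed.

Lemma entropy_action_value_le lam pi s :
  mean (pi s) (action_value M (entropy_reward lam pi) (soft_value lam) s) <= soft_value lam s.
Proof.
by rewrite entropy_action_value ler_wpM2l ?(ltW tau0)//; apply/gibbs/(action_gt0 M).
Qed.

Lemma soft_value_policy lam s :
  state_value M (entropy_reward lam (soft lam)) (soft lam) s = soft_value lam s.
Proof.
apply: state_value_unique => {}s.
by rewrite entropy_action_value /soft_policy gibbs_softmax.
Qed.

Lemma entropyE pi : entropy M pi = value M (fun s a => - ln (pi s a)) pi.
Proof.
rewrite /entropy mean_init_expected_sum -mulN1r -[RHS]mul1r -[LHS]addr0.
rewrite -[X in _ + X](mul0r (1 - gamma)^-1) -(value_cst M 0 pi) -valueZD mul1r.
by apply: eq_value => s; apply: eq_mean => a; rewrite mulN1r addr0.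
Qed.

Lemma value_rewards (u : 'rV[R]_m) pi :
  value M (fun s a => \sum_i u 0 i * reward M i s a) pi = dot u (V M pi).
Proof.
rewrite value_sum; apply: eq_bigr => i _; rewrite mxE -[RHS]addr0.
rewrite -[X in _ + X](mul0r (1 - gamma)^-1) -(value_cst M 0 pi) -valueZD.
by apply: eq_value => s; apply: eq_mean => a; rewrite addr0.
Qed.

Lemma reg_lagrangianE mu pi lam : reg_lagrangian M tau mu pi lam =
  value M (entropy_reward lam pi) pi - dot lam (threshold M) + mu / 2 * norm2 lam ^+ 2.
Proof.
rewrite /reg_lagrangian; congr (_ + _); rewrite /lagrangian entropyE dotDr dotNr.
rewrite -value_rewards /V0.
have -> : value M (entropy_reward lam pi) pi = tau * value M (fun s a => - ln (pi s a)) pi +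
    (1 * value M (reward0 M) pi + value M (fun s a => \sum_i lam 0 i * reward M i s a) pi).
  rewrite -!valueZD; apply: eq_value => s; apply: eq_mean => a.
  by rewrite /entropy_reward /lagr_reward; ring.
by ring.
Qed.

Lemma reg_lagrangian_le mu pi lam :
  reg_lagrangian M tau mu pi lam <= reg_lagrangian M tau mu (soft lam) lam.
Proof.
rewrite !reg_lagrangianE !lerD2r; apply: ler_mean => s.
rewrite soft_value_policy; apply: state_value_le => {}s.
exact: entropy_action_value_le.
Qed.

Lemma dualE mu lam : dual M tau mu lam = reg_lagrangian M tau mu (soft lam) lam.
Proof.
have ub : ubound [set reg_lagrangian M tau mu pi lam | pi in [set: policy R S A]]
    (reg_lagrangian M tau mu (soft lam) lam).
  by move=> _ [pi _ <-]; exact: reg_lagrangian_le.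
apply/eqP; rewrite eq_le; apply/andP; split.
  by apply: ge_sup => //; exists (reg_lagrangian M tau mu (soft lam) lam), (soft lam).
apply: ub_le_sup; first by exists (reg_lagrangian M tau mu (soft lam) lam).
by exists (soft lam).
Qed.

Lemma le_dual mu pi lam : reg_lagrangian M tau mu pi lam <= dual M tau mu lam.
Proof. by rewrite dualE; exact: reg_lagrangian_le. Qed.

(** Exact, since the Lagrangian is affine in the multiplier and the entropy does not involve it. The
    subgradient inequality, the smoothness and the accelerated step all start from this
    expansion. *)
Lemma reg_lagrangian_shift mu pi lam lam' : reg_lagrangian M tau mu pi lam' =
  reg_lagrangian M tau mu pi lam + dot (lam' - lam) (dual_grad_est M mu pi lam) +
  mu / 2 * dot (lam' - lam) (lam' - lam).
Proof.
rewrite /reg_lagrangian /lagrangian /dual_grad_est !norm2_sqr !dotE.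
rewrite [dot lam lam']dotC; lra.
Qed.

Lemma entropy_ge0 pi : 0 <= entropy M pi.
Proof.
rewrite entropyE; apply: value_ge0 => s a; rewrite oppr_ge0.
by apply: ln_le0; exact: dist_le1.
Qed.

Lemma entropy_le pi : entropy M pi <= ln #|A|%:R / (1 - gamma).
Proof.
rewrite entropyE -(value_cst M _ pi); apply: ler_value => s.
rewrite mean_cst; have := @gibbs _ _ (action_gt0 M) (pi s) (fun=> 0).
under eq_bigr do rewrite expR0.
rewrite sumr_const; congr (_ <= _).
by apply: eq_mean => a; rewrite sub0r.
Qed.

(* The soft value is the entropy-regularized value of its own softmax policy and dominates that of
   every other policy, so the comparison principle applies to the policy of [lam']. *)
Lemma soft_value_mono lam lam' h :
  (forall s a, lagr_reward M lam' s a <= lagr_reward M lam s a + h) ->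
  forall s, soft_value lam' s <= soft_value lam s + h / (1 - gamma).
Proof.
move=> H s; rewrite -soft_value_policy.
apply: (state_value_le (u := fun s => soft_value lam s + h / (1 - gamma))) => {}s.
apply: (le_trans (y := mean (soft lam' s)
   (fun a => action_value M (entropy_reward lam (soft lam')) (soft_value lam) s a +
     h / (1 - gamma)))).
  apply: ler_mean => a; rewrite /action_value /entropy_reward meanD mean_cst.
  rewrite [leRHS](_ : _ = lagr_reward M lam s a + h - tau * ln (soft lam' s a) +
    gamma * (mean (trans M s a) (soft_value lam) + h / (1 - gamma))).
    by rewrite lerD2r lerD2r; exact: H.
  by field; exact: dgamma0.
by rewrite meanD mean_cst lerD2r entropy_action_value_le.
Qed.

Lemma soft_Q_mono lam lam' h :
  (forall s a, lagr_reward M lam' s a <= lagr_reward M lam s a + h) ->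
  forall s a, soft_Q M tau lam' s a <= soft_Q M tau lam s a + h / (1 - gamma).
Proof.
move=> H s a; rewrite !soft_QE /action_value.
apply: (le_trans (y := lagr_reward M lam s a + h +
    gamma * (mean (trans M s a) (soft_value lam) + h / (1 - gamma)))).
  apply: lerD; first exact: H.
  rewrite ler_pM2l// -[X in _ + X](mean_cst (trans M s a)) -meanD; apply: ler_mean.
  exact: soft_value_mono.
by rewrite le_eqVlt; apply/orP; left; apply/eqP; field; exact: dgamma0.
Qed.

Let rmax i : R := max_reward (reward M i).

Let rmaxP i s a : reward M i s a <= rmax i.
Proof. exact: (le_bigmax _ (fun x : S * A => reward M i x.1 x.2) (s, a)). Qed.

Let R2 : R_max M ^+ 2 = \sum_i rmax i ^+ 2.
Proof. by rewrite sqr_sqrtr// sumr_ge0// => i _; exact: sqr_ge0. Qed.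

Lemma lipschitz_constant_ge0 k : 0 <= k ->
  0 <= (1 + k) * R_max M ^+ 2 / (2 * (1 - gamma) ^+ 2 * tau).
Proof.
move=> k0; apply: divr_ge0; first by apply: mulr_ge0; [exact: addr_ge0|exact: sqr_ge0].
by apply: mulr_ge0; [apply: mulr_ge0 => //; exact: sqr_ge0|exact: ltW].
Qed.

(** * Smoothness of the dual under a change of multiplier *)

Section Perturbation.
Context (lam lam' : 'rV[R]_m) (k : R).

Let d := lam' - lam.
Let f s a := \sum_i d 0 i * reward M i s a.

(** [k] is instantiated twice: by 4 L_nu - 1 for multipliers in the box, and by 1 / (1 - gamma) for
    the derivative at an arbitrary point. *)
Hypothesis spanP : forall h c, (forall s a s' a', h s a - h s' a' <= c) ->
  forall s s', state_value M h (soft lam) s - state_value M h (soft lam) s' <= k * c.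

(** Rewards lie between 0 and [rmax], so splitting [d] by sign encloses [f] in an interval of length
    sum_i |d_i| rmax_i; bounding |f| instead would double the span. *)
Let lo := \sum_i Num.min (d 0 i) 0 * rmax i.
Let hi := \sum_i Num.max (d 0 i) 0 * rmax i.

Let f_lo s a : lo <= f s a.
Proof.
apply: ler_sum => i _; have r0 := ltW (reward_gt0 M i s a).
have [d0|d0] := leP (d 0 i) 0; first by rewrite ler_wnM2l.
by rewrite mul0r mulr_ge0// ltW.
Qed.

Let f_hi s a : f s a <= hi.
Proof.
apply: ler_sum => i _; have r0 := ltW (reward_gt0 M i s a).
have [d0|d0] := leP (d 0 i) 0; first by rewrite mul0r mulr_le0_ge0.
by rewrite ler_wpM2l// ltW.
Qed.

Let fE s a : lagr_reward M lam' s a = lagr_reward M lam s a + f s a.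
Proof.
rewrite /lagr_reward -addrA; congr (_ + _); rewrite -big_split; apply: eq_bigr => i _ /=.
by rewrite /d !mxE; ring.
Qed.

Let hilo : (hi - lo) ^+ 2 <= R_max M ^+ 2 * dot d d.
Proof.
pose a : 'rV[R]_m := \row_i `|d 0 i|; pose b : 'rV[R]_m := \row_i rmax i.
have -> : hi - lo = dot a b.
  rewrite /hi /lo -sumrB; apply: eq_bigr => i _.
  rewrite [a 0 i]mxE [b 0 i]mxE -mulrBl; congr (_ * _).
  by have [d0|d0] := leP (d 0 i) 0; [rewrite ler0_norm//|rewrite gtr0_norm//]; ring.
have ab0 : 0 <= dot a b.
  apply: sumr_ge0 => i _; rewrite [a 0 i]mxE [b 0 i]mxE mulr_ge0//.
  by apply: bigmax_ge_id.
have -> : R_max M ^+ 2 * dot d d = (norm2 a * norm2 b) ^+ 2.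
  rewrite exprMn !norm2_sqr mulrC R2; congr (_ * _); apply: eq_bigr => i _.
    by rewrite [a 0 i]mxE -normrM ger0_norm// -expr2 sqr_ge0.
  by rewrite [b 0 i]mxE expr2.
by rewrite ler_pXn2r ?nnegrE// ?dot_norm2// mulr_ge0// sqrtr_ge0.
Qed.

Let hilo0 : 0 <= hi - lo.
Proof.
rewrite subr_ge0; apply: ler_sum => i _; apply: ler_wpM2r; first exact: bigmax_ge_id.
by have [] := leP (d 0 i) 0 => // /ltW.
Qed.

Lemma soft_policy_dTV s :
  dTV (soft lam' s) (soft lam s) <= (hi - lo) / (2 * (1 - gamma) * tau).
Proof.
have -> : (hi - lo) / (2 * (1 - gamma) * tau) =
  (hi / (1 - gamma) / tau - lo / (1 - gamma) / tau) / 2.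
  by field; rewrite ?dgamma0 ?taun0.
apply: dTV_softmax => a; rewrite -mulrBl.
apply/andP; split; rewrite ler_pM2r ?invr_gt0//.
  have H s' a' : lagr_reward M lam s' a' <= lagr_reward M lam' s' a' + - lo.
    by rewrite fE; have := f_lo s' a'; lra.
  by have := soft_Q_mono H s a; lra.
have H s' a' : lagr_reward M lam' s' a' <= lagr_reward M lam s' a' + hi.
  by rewrite fE; have := f_hi s' a'; lra.
by have := soft_Q_mono H s a; lra.
Qed.

Hypothesis k0 : 0 <= k.

Lemma value_gradient_lipschitz :
  dot d (V M (soft lam') - V M (soft lam)) <=
  (1 + k) * R_max M ^+ 2 / (2 * (1 - gamma) ^+ 2 * tau) * dot d d.
Proof.
have -> : dot d (V M (soft lam') - V M (soft lam)) =
    value M f (soft lam') - value M f (soft lam).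
  by rewrite dotBr; congr (_ - _); exact/esym/value_rewards.
apply: (le_trans (value_performance_difference (b :=
  (hi - lo) / (2 * (1 - gamma) * tau) * ((1 + k) * (hi - lo))) _)).
  move=> s; set v := state_value _ _ _.
  have Q a a' : action_value M f v s a - action_value M f v s a' <= (1 + k) * (hi - lo).
    have H1 := lerB (f_hi s a) (f_lo s a').
    have H2 : mean (trans M s a) v - mean (trans M s a') v <= k * (hi - lo).
      have vv s1 s2 : v s1 - v s2 <= k * (hi - lo).
        apply: spanP => x1 a1 x2 a2; have := f_hi x1 a1; have := f_lo x2 a2; lra.
      rewrite lerBlDl -[leLHS](mean_cst (trans M s a')) -[X in _ + X](mean_cst (trans M s a')).
      rewrite -meanD; apply: ler_mean => s1.
      rewrite -[leRHS](mean_cst (trans M s a)); apply: ler_mean => s2.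
      by have := vv s2 s1; lra.
    have H3 : gamma * (mean (trans M s a) v - mean (trans M s a') v) <= k * (hi - lo).
      apply: (le_trans (y := gamma * (k * (hi - lo)))).
        by rewrite ler_wpM2l// ltW.
      by rewrite ler_piMl ?mulr_ge0// ltW// discount_lt1.
    by rewrite /action_value; lra.
  apply: le_trans (mean_dTV (action_gt0 M) _ Q) _; first by rewrite !dist_sum1.
  apply: ler_wpM2r; last exact: soft_policy_dTV.
  by apply: mulr_ge0 => //; apply: addr_ge0.
have -> : (hi - lo) / (2 * (1 - gamma) * tau) * ((1 + k) * (hi - lo)) / (1 - gamma) =
  (1 + k) / (2 * (1 - gamma) ^+ 2 * tau) * (hi - lo) ^+ 2.
  by field; rewrite ?dgamma0 ?taun0.
have -> : (1 + k) * R_max M ^+ 2 / (2 * (1 - gamma) ^+ 2 * tau) * dot d d =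
  (1 + k) / (2 * (1 - gamma) ^+ 2 * tau) * (R_max M ^+ 2 * dot d d).
  by ring.
apply: ler_wpM2l => //; apply: divr_ge0; first exact: addr_ge0.
by apply: mulr_ge0; [apply: mulr_ge0 => //; exact: sqr_ge0|exact: ltW].
Qed.

(* By convexity the second-order remainder is at most the variation of the gradient along d; this
   loses a factor 2 over integrating the gradient, which Ld leaves room for. *)
Lemma dual_smooth mu : dual M tau mu lam' <= dual M tau mu lam +
  dot d (dual_grad_est M mu (soft lam) lam) +
  ((1 + k) * R_max M ^+ 2 / (2 * (1 - gamma) ^+ 2 * tau) + mu / 2) * dot d d.
Proof.
rewrite [leLHS]dualE (reg_lagrangian_shift _ _ lam) -/d.
have H1 := le_dual mu (soft lam') lam.
have H2 := value_gradient_lipschitz.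
have -> : dual_grad_est M mu (soft lam') lam =
    dual_grad_est M mu (soft lam) lam + (V M (soft lam') - V M (soft lam)).
  by rewrite /dual_grad_est [RHS]addrC !addrA subrK.
rewrite (dotDr d (dual_grad_est M mu (soft lam) lam)).
set x := dot d (dual_grad_est _ _ _ _); set y := dot d (V _ _ - _) in H2 *.
set z := dot d d in H2 *; set K := (_ / _ : R) in H2 *; set w := mu / 2.
by move: x y z K w (dual _ _ _ _) (reg_lagrangian _ _ _ _ _) H1 H2 => x y z K w D L; lra.
Qed.

End Perturbation.

Lemma dual_subgradient mu lam lam' :
  dual M tau mu lam + dot (lam' - lam) (dual_grad_est M mu (soft lam) lam) +
    mu / 2 * dot (lam' - lam) (lam' - lam) <= dual M tau mu lam'.
Proof. by rewrite (dualE mu lam) -reg_lagrangian_shift; exact: le_dual. Qed.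

Lemma state_value_span h c pi : (forall s a s' a', h s a - h s' a' <= c) ->
  forall s s', state_value M h pi s - state_value M h pi s' <= (1 - gamma)^-1 * c.
Proof.
move=> H s1 s2; have [a0 _] := card_gt0P (action_gt0 M).
pose x0 := [arg min_(x < (s1, a0)) h x.1 x.2]%O.
have x0P s a : h x0.1 x0.2 <= h s a.
  by rewrite /x0; case: Order.TotalTheory.arg_minP => // i _ /(_ (s, a)); exact.
set l := h x0.1 x0.2 in x0P.
have cstE b s : b / (1 - gamma) = mean (pi s) (fun a => b + gamma * (b / (1 - gamma))).
  by rewrite mean_cst; field; exact: dgamma0.
have : state_value M h pi s1 <= (l + c) / (1 - gamma).
  apply: (state_value_le (u := fun=> (l + c) / (1 - gamma))) => s.
  rewrite [leRHS](cstE _ s); apply: ler_mean => a; rewrite /action_value mean_cst lerD2r.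
  by have := H s a x0.1 x0.2; rewrite -/l; lra.
have : l / (1 - gamma) <= state_value M h pi s2.
  apply: (state_value_ge (u := fun=> l / (1 - gamma))) => s.
  rewrite [leLHS](cstE _ s); apply: ler_mean => a; rewrite /action_value mean_cst lerD2r.
  exact: x0P.
by rewrite mulrDl [_ * c]mulrC; lra.
Qed.

(* No ergodicity here: the partial derivatives may leave the box, so the crude span bound
   (1 - gamma)^-1 is used. *)
Lemma dual_gradient mu lam :
  gradient (dual M tau mu) lam = dual_grad_est M mu (soft lam) lam.
Proof.
apply/rowP => i; rewrite mxE.
set e := delta_mx 0 i; set g := dual_grad_est _ _ _ _.
have eg : dot e g = g 0 i.
  rewrite /dot (bigD1 i)//= big1 ?addr0 => [|j /negbTE ji]; rewrite !mxE ?eqxx ?mul1r//.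
  by rewrite ji andbF mul0r.
(* The subgradient inequality from below and [dual_smooth] from above squeeze the increment to its
   linear part up to C h^2. No sign of [mu] is assumed, hence [|mu|] in the witness. *)
have [C C0 HC] : exists2 C : R, 0 <= C & forall h : R,
    `|dual M tau mu (h *: e + lam) - dual M tau mu lam - h * g 0 i| <= C * h ^+ 2.
  pose K := (1 - gamma)^-1; pose C0 := (1 + K) * R_max M ^+ 2 / (2 * (1 - gamma) ^+ 2 * tau).
  have K0 : 0 <= K by rewrite invr_ge0 ltW.
  have C00 : 0 <= C0 := lipschitz_constant_ge0 K0.
  exists ((C0 + `|mu|) * dot e e); first by rewrite mulr_ge0 ?dot_ge0// addr_ge0.
  move=> h.
  have sm := @dual_smooth lam (h *: e + lam) K (fun f c H => state_value_span _ H) K0 mu.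
  have sg := dual_subgradient mu lam (h *: e + lam).
  rewrite -/C0 addrK -/g in sm sg.
  rewrite !(dotZl e h) !(dotZr e h e) eg in sm sg.
  have ee : 0 <= h ^+ 2 * dot e e by rewrite mulr_ge0 ?sqr_ge0 ?dot_ge0.
  have m1 := ler_wpM2r ee (ler_norm mu).
  have m2 : 0 <= (mu + `|mu|) * (h ^+ 2 * dot e e).
    by apply: mulr_ge0 => //; have := ler_norm (- mu); rewrite normrN; lra.
  have m3 := mulr_ge0 C00 ee.
  move: sm sg m1 m2 m3; rewrite ler_norml; clearbody C0 g.
  move: (dual M _ _ _) (dual M _ _ _) (dot e e) `|mu| => d1 d2 ee' am sm sg m1 m2 m3.
  by apply/andP; split; lra.
apply/cvg_lim => //; apply/cvgrPdist_le => eps eps0.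
near=> h.
have h0 : h != 0 by near: h; exact: nbhs_dnbhs_neq.
have := HC h; rewrite /= => Hh.
have -> : g 0 i - h^-1 *: (dual M tau mu (h *: e + lam) - dual M tau mu lam) =
  - (h^-1 * (dual M tau mu (h *: e + lam) - dual M tau mu lam - h * g 0 i)).
  by rewrite mulrBr mulrA mulVf// mul1r opprB.
rewrite normrN normrM normfV ler_pdivrMl ?normr_gt0//.
apply: (le_trans Hh); rewrite -real_normK ?num_real// expr2 mulrCA ler_wpM2l//.
have hC : `|h| <= eps / (C + 1).
  by near: h; apply: dnbhs0_le; rewrite divr_gt0// ltr_wpDl.
apply: (le_trans (ler_wpM2l C0 hC)).
rewrite mulrCA ler_piMr ?(ltW eps0)// ler_pdivrMr ?ltr_wpDl// mul1r lerDl//.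
Unshelve. all: by end_near. Qed.

End RegularizedMDP.

(** * One accelerated step *)

Section AcceleratedStep.
Context (R : realType) (m : nat).
Implicit Types (x y z l g : 'rV[R]_m) (B : R).

Lemma box_convex B c x y : 0 <= c <= 1 -> box B x -> box B y ->
  box B ((1 - c) *: x + c *: y).
Proof.
move=> /andP[c0 c1] xB yB i; rewrite !mxE.
have /andP[x0 x1] := xB i; have /andP[y0 y1] := yB i; have d0 : 0 <= 1 - c by lra.
apply/andP; split; first by rewrite addr_ge0// mulr_ge0.
have := ler_wpM2l d0 x1; have := ler_wpM2l c0 y1; lra.
Qed.

Lemma box_dist B x y : 0 <= B -> box B x -> box B y ->
  norm2 (x - y) <= 2 * (Num.sqrt m%:R * B).
Proof.
move=> B0 xB yB; have r0 : 0 <= 2 * (Num.sqrt m%:R * B) by rewrite !mulr_ge0 ?sqrtr_ge0.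
rewrite -(ler_pXn2r (n := 2))// ?nnegrE ?sqrtr_ge0// norm2_sqr !exprMn sqr_sqrtr//.
apply: le_trans (_ : \sum_(i < m) (2 * B) ^+ 2 <= _).
  apply: ler_sum => i _; rewrite !mxE -expr2 -real_normK ?num_real//.
  rewrite ler_pXn2r ?nnegrE ?mulr_ge0//.
  have /andP[x0 x1] := xB i; have /andP[y0 y1] := yB i.
  by rewrite ler_norml; apply/andP; split; lra.
by rewrite sumr_const card_ord -mulr_natl exprMn le_eqVlt; apply/orP; left; apply/eqP; ring.
Qed.

Lemma box_sqr B x : 0 <= B -> box B x -> dot x x <= 4 * m%:R * B ^+ 2.
Proof.
move=> B0 xB; rewrite -norm2_sqr.
have box0 : box B (0 : 'rV[R]_m) by move=> i; rewrite mxE lexx mulr_ge0.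
have := box_dist B0 xB box0; rewrite subr0.
rewrite -(ler_pXn2r (n := 2)) ?nnegrE ?sqrtr_ge0 ?mulr_ge0 ?sqrtr_ge0//.
rewrite !exprMn (@sqr_sqrtr _ m%:R)// => /le_trans; apply.
by rewrite le_eqVlt; apply/orP; left; apply/eqP; ring.
Qed.

(** Along the segment from [y] to [l] the objective is a quadratic polynomial [F]; minimality of [y]
    makes its linear coefficient [a] nonnegative, and the inequality is then [F] at 1. *)
Lemma box_prox B eta mu g x y z l : 0 <= eta -> 0 <= mu -> box B l ->
  is_argmin (box B) (fun l => eta * (dot g l + mu / 2 * norm2 (l - z) ^+ 2) +
    2^-1 * norm2 (l - x) ^+ 2) y ->
  eta * (dot g y + mu / 2 * dot (y - z) (y - z)) + 2^-1 * dot (y - x) (y - x) +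
    (eta * mu + 1) / 2 * dot (l - y) (l - y) <=
  eta * (dot g l + mu / 2 * dot (l - z) (l - z)) + 2^-1 * dot (l - x) (l - x).
Proof.
move=> eta0 mu0 lB [yB ymin].
pose a := eta * (dot g (l - y) + mu * dot (y - z) (l - y)) + dot (y - x) (l - y).
pose b := (eta * mu + 1) / 2 * dot (l - y) (l - y).
have b0 : 0 <= b.
  by rewrite mulr_ge0 ?dot_ge0// divr_ge0// addr_ge0// mulr_ge0.
have F s : eta * (dot g (y + s *: (l - y)) +
    mu / 2 * dot (y + s *: (l - y) - z) (y + s *: (l - y) - z)) +
    2^-1 * dot (y + s *: (l - y) - x) (y + s *: (l - y) - x) =
  eta * (dot g y + mu / 2 * dot (y - z) (y - z)) + 2^-1 * dot (y - x) (y - x) + s * a + s ^+ 2 * b.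
  rewrite /a /b -![y + _ - _]addrAC; move: (l - y) (y - z) (y - x) => v p w.
  by rewrite !dotE [dot v p]dotC [dot v w]dotC; field.
have a0 : 0 <= a.
  rewrite leNgt; apply/negP => a0.
  (* Dividing by b - a keeps r <= 1 and covers b = 0; the change of the objective at this point is -
     r a^2 / (b - a) < 0. *)
  pose r := - a / (b - a); have ba : 0 < b - a by lra.
  have r0 : 0 < r by rewrite divr_gt0// oppr_gt0.
  have r1 : r <= 1 by rewrite ler_pdivrMr//; lra.
  have pB : box B (y + r *: (l - y)).
    rewrite (_ : _ + _ = (1 - r) *: y + r *: l); first by apply: box_convex => //; rewrite r1 ltW.
    by rewrite scalerBr scalerBl scale1r addrCA addrC.
  have := ymin _ pB; rewrite !norm2_sqr F -addrA lerDl expr2 -mulrA -mulrDr pmulr_rge0//.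
  have -> : a + r * b = - (a ^+ 2 / (b - a)).
    by rewrite /r; field; rewrite gt_eqF.
  rewrite oppr_ge0 leNgt divr_gt0// exprn_even_gt0//= lt_eqF//.
have := F 1; rewrite scale1r [y + (l - y)]addrC subrK => ->.
by rewrite expr1n !mul1r -/b; lra.
Qed.

(** [Dyb], [Dz] and [Dxb] stand for the dual at the three points, which leaves pure algebra: the sum
    of smoothness, (1 - alpha) times the subgradient inequality, the proximal inequality and [N]. An
    inexact gradient costs only the last inner product. *)
Lemma accelerated_step (mu L1 alpha Dyb Dz Dxb : R) (xb x y z l g gs : 'rV[R]_m) :
  0 < mu -> 0 < alpha -> alpha < 1 -> 0 <= L1 ->
  (L1 + mu) * alpha ^+ 2 = mu / 2 ->
  (1 + alpha) *: z = xb + alpha *: x ->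
  let yb := (1 - alpha) *: xb + alpha *: y in
  Dyb <= Dz + dot (yb - z) gs + (L1 + mu / 2) * dot (yb - z) (yb - z) ->
  Dz + dot (xb - z) gs + mu / 2 * dot (xb - z) (xb - z) <= Dxb ->
  alpha * (dot g y + mu / 2 * dot (y - z) (y - z)) +
    mu * (1 - alpha) / 2 * dot (y - x) (y - x) + mu / 2 * dot (l - y) (l - y) <=
  alpha * (dot g l + mu / 2 * dot (l - z) (l - z)) +
    mu * (1 - alpha) / 2 * dot (l - x) (l - x) ->
  Dyb + mu / 2 * dot (l - y) (l - y) <=
  (1 - alpha) * (Dxb + mu / 2 * dot (l - x) (l - x)) +
  alpha * (Dz + dot (l - z) g + mu / 2 * dot (l - z) (l - z) + dot (g - gs) (z - y)).
Proof.
move=> mu0 a0 a1 L10 La zE yb Ha Hb Hd.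
have ybz : yb - z = (1 - alpha) *: (xb - z) + alpha *: (y - z).
  by rewrite /yb; apply/rowP => i; rewrite !mxE; ring.
(* The choice of [z] makes yb - z a multiple of alpha (y - xb) + (y - x). The term in y - x is paid
   by the proximal term, the one in y - xb by the convexity defect of |. - z|^2 at [yb]. *)
have N : L1 * dot (yb - z) (yb - z) <=
    mu * (1 - alpha) / 2 * (dot (y - x) (y - x) + alpha * dot (y - xb) (y - xb)).
  have n0 : 0 < 1 + alpha by lra.
  have -> : yb - z = (alpha / (1 + alpha)) *: (alpha *: (y - xb) + (y - x)).
    have -> : z = (1 + alpha)^-1 *: (xb + alpha *: x).
      by rewrite -zE scalerA mulVf ?scale1r ?gt_eqF.
    rewrite /yb.
    by apply/rowP => i; rewrite !mxE; field; rewrite gt_eqF.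
  move: (y - xb) (y - x) => a b.
  have ab : alpha ^+ 2 * dot a a + 2 * alpha * dot a b + dot b b <=
      (1 + alpha) * (dot b b + alpha * dot a a).
    have := mulr_ge0 (ltW a0) (dot_ge0 (a - b)).
    by rewrite !dotE [dot b a]dotC; lra.
  have -> : L1 * dot (alpha / (1 + alpha) *: (alpha *: a + b))
      (alpha / (1 + alpha) *: (alpha *: a + b)) =
    L1 * alpha ^+ 2 / (1 + alpha) ^+ 2 * (alpha ^+ 2 * dot a a + 2 * alpha * dot a b + dot b b).
    by rewrite !dotE [dot b a]dotC; field; rewrite gt_eqF.
  have c0 : 0 <= L1 * alpha ^+ 2 / (1 + alpha) ^+ 2.
    by apply: divr_ge0; [apply: mulr_ge0 => //|]; exact: sqr_ge0.
  apply: le_trans (ler_wpM2l c0 ab) _.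
  have -> : L1 * alpha ^+ 2 / (1 + alpha) ^+ 2 * ((1 + alpha) * (dot b b + alpha * dot a a)) =
    L1 * alpha ^+ 2 / (1 + alpha) * (dot b b + alpha * dot a a).
    by field; rewrite gt_eqF.
  apply: ler_wpM2r; first by rewrite addr_ge0 ?dot_ge0// mulr_ge0 ?dot_ge0// ltW.
  rewrite ler_pdivrMr//.
  have -> : L1 * alpha ^+ 2 = mu / 2 - mu * alpha ^+ 2 by rewrite -La; ring.
  have := mulr_ge0 (ltW mu0) (sqr_ge0 alpha); lra.
have a1' : 0 <= 1 - alpha by lra.
have {}Hb := ler_wpM2l a1' Hb.
have xbyE : y - xb = (y - z) - (xb - z) by rewrite opprB addrA subrK.
have gE : dot g y = dot g l + dot (l - z) g * 0 - dot g (l - z) + dot g (y - z).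
  by rewrite !dotE; ring.
rewrite xbyE in N; rewrite gE in Hd.
have -> : z - y = - (y - z) by rewrite opprB.
rewrite ybz in Ha N; clear ybz xbyE gE La zE.
rewrite -[dot (l - z) g]dotC.
move: (y - z) (xb - z) (l - z) (y - x) (l - x) (l - y) Ha Hb Hd N => Y X Lz W V U.
have -> : dot (g - gs) (- Y) = dot gs Y - dot g Y by rewrite !dotE; ring.
rewrite !dotE [dot Y X]dotC [dot X gs]dotC [dot Y gs]dotC [dot Lz g]dotC.
set A1 := dot gs X; set A2 := dot gs Y; set A3 := dot X X; set A4 := dot X Y.
set A5 := dot Y Y; set A6 := dot g Y; set A7 := dot g l; set A8 := dot g Lz.
set A9 := dot U U; set A10 := dot Lz Lz; set A11 := dot W W; set A12 := dot V V.
clearbody A1 A2 A3 A4 A5 A6 A7 A8 A9 A10 A11 A12.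
move=> Ha Hb Hd N; rewrite -subr_ge0 in Ha; rewrite -subr_ge0 in Hb.
rewrite -subr_ge0 in Hd; rewrite -subr_ge0 in N; rewrite -subr_ge0.
have := addr_ge0 (addr_ge0 Ha Hb) (addr_ge0 Hd N).
by congr (0 <= _); field.
Qed.

End AcceleratedStep.

(** * The constrained optimum *)

Section ConstrainedOptimum.
Context (R : realType) (S A : finType) (m : nat) (M : cmdp R S A m).
Implicit Types (pi : policy R S A) (f : S -> A -> R).

Local Notation gamma := (discount M).

Let dgamma : 0 < 1 - gamma.
Proof. by rewrite subr_gt0 discount_lt1. Qed.

(** Averaging action probabilities state by state does not average values, whereas the quotient of
    mixed occupancies does; [policy_mix] takes its policy from here. *)
Lemma output_exists T alpha (pi : nat -> policy R S A) :
  (0 < T)%N -> 0 <= alpha <= 1 -> exists pit, is_output M T alpha pi pit.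
Proof.
move=> T0 a01.
pose nu s a := mixture T alpha (fun t => occupancy M (pi t) s a).
pose chi s := mixture T alpha (fun t => state_occupancy M (pi t) s).
have chiE s : chi s = \sum_a nu s a by rewrite /chi /nu -mixture_sum.
have nu0 s a : 0 <= nu s a by apply: mixture_ge0 => // t; exact: occupancy_ge0.
have chi0 s : 0 <= chi s by rewrite chiE sumr_ge0.
have ex s : exists d : dist R A, chi s != 0 -> forall a, d a = nu s a / chi s.
  have [c0|c0] := eqVneq (chi s) 0; first by exists (pi 0%N s).
  have d0 a : 0 <= nu s a / chi s by rewrite divr_ge0.
  have d1 : \sum_a nu s a / chi s = 1 by rewrite -mulr_suml -chiE divff.
  by exists (Dist d0 d1).
have [pit pitP] := choice ex.
by exists pit => s a /(pitP s).
Qed.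

Lemma policy_mix kappa (pi1 pi2 : policy R S A) : 0 <= kappa <= 1 ->
  exists pi, forall f, value M f pi = (1 - kappa) * value M f pi1 + kappa * value M f pi2.
Proof.
(* With T = 2 the output of the algorithm is the mixture of two policies. *)
move=> k01; pose ps t := if t == 1%N then pi1 else pi2.
have [pi out] := @output_exists 2 kappa ps isT k01.
by exists pi => f; rewrite (output_value f _ k01 out)// mixtureS// mixture1.
Qed.

Lemma max_rewardP f s a : f s a <= max_reward f.
Proof. exact: (le_bigmax _ (fun x : S * A => f x.1 x.2) (s, a)). Qed.

Lemma value_le_max f pi : value M f pi <= max_reward f / (1 - gamma).
Proof.
rewrite -(value_cst M _ pi); apply: ler_value => s; apply: ler_mean => a.
exact: max_rewardP.
Qed.

Lemma V_ge0 pi i : 0 <= V M pi 0 i.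
Proof. by rewrite mxE; apply: value_ge0 => s a; rewrite ltW// reward_gt0. Qed.

Lemma V_le pi i : V M pi 0 i <= max_reward (reward M i) / (1 - gamma).
Proof. by rewrite mxE value_le_max. Qed.

Lemma V0_ge0 pi : 0 <= V0 M pi.
Proof. by apply: value_ge0 => s a; rewrite ltW// reward0_gt0. Qed.

Lemma V0_le pi : V0 M pi <= r0_max M / (1 - gamma).
Proof. exact: value_le_max. Qed.

Lemma sum_max_reward : \sum_i max_reward (reward M i) <= Num.sqrt m%:R * R_max M.
Proof.
pose a : 'rV[R]_m := \row_i max_reward (reward M i); pose b : 'rV[R]_m := const_mx 1.
have -> : \sum_i max_reward (reward M i) = dot b a.
  by apply: eq_bigr => i _; rewrite !mxE mul1r.
apply: le_trans (dot_norm2 _ _) _; rewrite le_eqVlt; apply/orP; left; apply/eqP.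
congr (_ * _); congr Num.sqrt.
  under eq_bigr do rewrite mxE expr1n.
  by rewrite sumr_const card_ord.
by apply: eq_bigr => i _; rewrite mxE.
Qed.

(** Both vectors have coordinates between 0 and the same maximum, so no factor 2 is lost. This
    controls the gradient error. *)
Lemma V_dist pi pi' : norm2 (V M pi - V M pi') <= R_max M / (1 - gamma).
Proof.
have r0 : 0 <= R_max M / (1 - gamma) by rewrite divr_ge0 ?sqrtr_ge0// ltW.
rewrite -(ler_pXn2r (n := 2))// ?nnegrE ?sqrtr_ge0// norm2_sqr.
rewrite expr_div_n sqr_sqrtr; last by rewrite sumr_ge0// => i _; exact: sqr_ge0.
rewrite mulr_suml; apply: ler_sum => i _; rewrite -exprVn -exprMn.
have -> : (V M pi - V M pi') 0 i = V M pi 0 i - V M pi' 0 i by rewrite !mxE.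
rewrite -expr2 -real_normK ?num_real// ler_pXn2r ?nnegrE ?mulr_ge0 ?invr_ge0
  ?(ltW dgamma)//; last first.
  exact: bigmax_ge_id.
have := V_ge0 pi i; have := V_ge0 pi' i; have := V_le pi i; have := V_le pi' i.
by rewrite ler_norml => h1 h2 h3 h4; apply/andP; split; lra.
Qed.

Lemma V0_opt_le_dual tau mu (lam : 'rV[R]_m) pi : 0 < tau -> 0 <= mu -> feasible M pi ->
  (forall i, 0 <= lam 0 i) -> V0_opt M <= dual M tau mu lam.
Proof.
move=> tau0 mu0 fpi lam0; apply: ge_sup; first by exists (V0 M pi), pi.
move=> _ [pi' f' <-]; apply: le_trans (le_dual M tau0 mu pi' lam).
rewrite /reg_lagrangian /lagrangian -!addrA lerDl.
have h1 : 0 <= dot lam (V M pi' - threshold M).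
  apply: sumr_ge0 => i _; apply: mulr_ge0 => //.
  by have := f' i; rewrite !mxE subr_ge0.
have h2 : 0 <= tau * entropy M pi' by rewrite mulr_ge0 ?entropy_ge0// ltW.
have h3 : 0 <= mu / 2 * norm2 lam ^+ 2 by rewrite mulr_ge0 ?sqr_ge0// divr_ge0.
by rewrite !addr_ge0.
Qed.

Lemma norm1_pospart (u : 'rV[R]_m) : norm1 (pospart u) = \sum_i Num.max (u 0 i) 0.
Proof. by apply: eq_bigr => i _; rewrite mxE ger0_norm// le_max lexx orbT. Qed.

(* Mixing [pi] with the Slater policy in proportion v / (v + xi) restores feasibility. *)
Lemma V0_opt_ge xi pi : slater M xi ->
  V0 M pi - r0_max M / ((1 - gamma) * xi) * norm1 (pospart (threshold M - V M pi)) <= V0_opt M.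
Proof.
move=> [xi0 [pis slat]]; set v := norm1 _.
have v0 : 0 <= v by rewrite /v norm1_pospart sumr_ge0// => i _; rewrite le_max lexx orbT.
have vx : 0 < v + xi by lra.
pose kappa := v / (v + xi).
have k0 : 0 <= kappa by rewrite divr_ge0// ltW.
have k1 : kappa <= 1 by rewrite ler_pdivrMr//; lra.
have [|pi' pi'E] := @policy_mix kappa pi pis; first by rewrite k0.
have f' : feasible M pi'.
  move=> i; have := slat i; rewrite !mxE pi'E => si.
  have vi : threshold M 0 i - value M (reward M i) pi <= v.
    rewrite /v norm1_pospart (bigD1 i)//= -[leLHS]addr0; apply: lerD.
      by rewrite !mxE le_max lexx.
    by rewrite sumr_ge0// => j _; rewrite le_max lexx orbT.
  have -> : threshold M 0 i = (1 - kappa) * (threshold M 0 i - v) + kappa * (threshold M 0 i + xi).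
    by rewrite /kappa; field; rewrite gt_eqF.
  by apply: lerD; apply: ler_wpM2l => //; lra.
have V0'opt : V0 M pi' <= V0_opt M.
  apply: ub_le_sup; last by exists pi'.
  by exists (r0_max M / (1 - gamma)) => _ [pi1 _ <-]; exact: V0_le.
apply: le_trans V0'opt; rewrite /V0 pi'E -!/(V0 M _).
(* The inequality kappa <= v / xi turns the loss of objective into [v] times r0_max / ((1 - gamma)
   xi), the value prescribed for [B]. *)
have h1 : kappa * V0 M pi <= v / xi * (r0_max M / (1 - gamma)).
  apply: ler_pM => //; [exact: V0_ge0| |exact: V0_le].
  by rewrite /kappa ler_wpM2l// lef_pV2 ?posrE//; lra.
have h2 : 0 <= kappa * V0 M pis by rewrite mulr_ge0// V0_ge0.
have -> : r0_max M / ((1 - gamma) * xi) * v = v / xi * (r0_max M / (1 - gamma)).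
  by field; rewrite !gt_eqF.
lra.
Qed.

Lemma lagrangianE pi lam :
  lagrangian M pi lam = value M (lagr_reward M lam) pi - dot lam (threshold M).
Proof.
rewrite /lagrangian dotBr addrA -value_rewards -[V0 M pi]mul1r -valueZD.
by congr (_ - _); apply: eq_value => s; apply: eq_mean => a; rewrite mul1r.
Qed.

Lemma output_lagrangian T alpha (pi : nat -> policy R S A) pit lam :
  (0 < T)%N -> 0 <= alpha <= 1 -> is_output M T alpha pi pit ->
  mixture T alpha (fun t => lagrangian M (pi t) lam) = lagrangian M pit lam.
Proof.
move=> T0 a01 out; rewrite lagrangianE (output_value _ T0 a01 out).
rewrite (eq_mixture _ _ (g := fun t => 1 * value M (lagr_reward M lam) (pi t) +
  - dot lam (threshold M))); first by rewrite mixtureZD// mixture_cst// mul1r.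
by move=> t; rewrite lagrangianE mul1r.
Qed.

End ConstrainedOptimum.

(** * The run *)

Section StepSizes.
Context (R : realType) (mu Ld alpha q eta : R).
Hypotheses (mu0 : 0 < mu) (muLd : mu <= Ld)
  (alphaE : alpha = Num.sqrt (mu / (2 * Ld)))
  (qE : q = (2 * alpha - mu / Ld) / (2 - mu / Ld))
  (etaE : eta = alpha / (mu * (1 - alpha))).

Let Ld0 : 0 < Ld. Proof. exact: lt_le_trans muLd. Qed.

Lemma alpha_sqr : alpha ^+ 2 = mu / (2 * Ld).
Proof. by rewrite alphaE sqr_sqrtr// divr_ge0// ?mulr_ge0// ltW. Qed.

Lemma alpha_gt0 : 0 < alpha.
Proof. by rewrite alphaE sqrtr_gt0 divr_gt0// mulr_gt0. Qed.

Lemma alpha_lt1 : alpha < 1.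
Proof.
have : alpha ^+ 2 < 1.
  by rewrite alpha_sqr ltr_pdivrMr ?mulr_gt0//; have := Ld0; have := muLd; lra.
by rewrite expr_lt1// ltW// alpha_gt0.
Qed.

(** As mu / Ld = 2 alpha^2, the factor 1 - alpha cancels. This is the form that gives the
    extrapolation condition of [accelerated_step]. *)
Lemma mix_stepE : q = alpha / (1 + alpha).
Proof.
have a1 := alpha_lt1; have a0 := alpha_gt0.
have -> : q = (2 * alpha - 2 * alpha ^+ 2) / (2 - 2 * alpha ^+ 2).
  rewrite qE; have -> : mu / Ld = 2 * alpha ^+ 2 by rewrite alpha_sqr; field; rewrite gt_eqF.
  by [].
field; rewrite gt_eqF/= ?gt_eqF//; last lra.
have := mulr_gt0 a0 (_ : 0 < 1 - alpha); rewrite expr2; lra.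
Qed.

Lemma eta_gt0 : 0 < eta.
Proof. by rewrite etaE divr_gt0 ?alpha_gt0// mulr_gt0// subr_gt0 alpha_lt1. Qed.

(** Multiplying the proximal inequality by mu (1 - alpha) thus eliminates [eta]. *)
Lemma alpha_eta : mu * (1 - alpha) * eta = alpha.
Proof. by rewrite etaE; field; rewrite !gt_eqF// subr_gt0 alpha_lt1. Qed.

Lemma sqrt_condition : Num.sqrt (2 * Ld / mu) = alpha^-1.
Proof. by rewrite alphaE -sqrtrV ?divr_ge0 ?mulr_ge0 ?(ltW mu0) ?(ltW Ld0)// invf_div. Qed.

End StepSizes.

Section Run.
Context (R : realType) (S A : finType) (m : nat) (M : cmdp R S A m)
  (tau mu delta CM beta B Ld alpha q eta : R) (T : nat)
  (pi : nat -> policy R S A) (lamu lam lamb : nat -> 'rV[R]_m).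

Local Notation gamma := (discount M).
Local Notation soft := (soft_policy M tau).

Hypotheses (tau0 : 0 < tau) (mu0 : 0 < mu) (B0 : 0 <= B)
  (LdE : Ld = 2 * R_max M ^+ 2 * L_nu CM beta / ((1 - gamma) ^+ 2 * tau) + mu)
  (alphaE : alpha = Num.sqrt (mu / (2 * Ld)))
  (qE : q = (2 * alpha - mu / Ld) / (2 - mu / Ld))
  (etaE : eta = alpha / (mu * (1 - alpha)))
  (ergodic : uniformly_ergodic M tau B CM beta) (L_nu1 : 1 <= L_nu CM beta)
  (run : ar_cpo M T eta alpha q tau mu delta B pi lamu lam lamb).

Let dgamma : 0 < 1 - gamma.
Proof. by rewrite subr_gt0 discount_lt1. Qed.

Lemma le_mu_Ld : mu <= Ld.
Proof.
rewrite LdE lerDr; apply: divr_ge0; last by rewrite mulr_ge0 ?sqr_ge0// ltW.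
by apply: mulr_ge0; [apply: mulr_ge0 => //; exact: sqr_ge0|exact: le_trans ler01 L_nu1].
Qed.

Let a0 : 0 < alpha := alpha_gt0 mu0 le_mu_Ld alphaE.
Let a1 : alpha < 1 := alpha_lt1 mu0 le_mu_Ld alphaE.
Let q01 : 0 <= q <= 1.
Proof.
rewrite (mix_stepE mu0 le_mu_Ld alphaE qE); have n0 : 0 < 1 + alpha by rewrite addr_gt0.
by rewrite divr_ge0 ?(ltW a0) ?(ltW n0)//= ler_pdivrMr//; lra.
Qed.

Lemma run_box t : (t <= T)%N -> box B (lam t) /\ box B (lamb t).
Proof.
elim: t => [|t IH] tT.
  rewrite (ar_cpo_lam0 run) (ar_cpo_lamb0 run).
  by split=> i; rewrite mxE lexx mulr_ge0.
have [lB lbB] := IH (ltnW tT).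
have [lB' _] := ar_cpo_lam run tT; split=> //.
by rewrite (ar_cpo_lamb run tT); apply: box_convex => //; rewrite (ltW a0) ltW.
Qed.

Lemma run_box_under t : (t < T)%N -> box B (lamu t.+1).
Proof.
move=> tT; have [lB lbB] := run_box (ltnW tT).
by rewrite (ar_cpo_lamu run tT); apply: box_convex.
Qed.

Lemma run_lamu1 : (0 < T)%N -> lamu 1%N = 0.
Proof.
by move=> T0; rewrite (ar_cpo_lamu run T0) (ar_cpo_lam0 run) (ar_cpo_lamb0 run) !scaler0 addr0.
Qed.

Let gap t := V0 M (soft (lamu t)) + dot (lamu t) (V M (soft (lamu t)) - threshold M) -
  (V0 M (pi t) + dot (lamu t) (V M (pi t) - threshold M)).
Let grad_err t := dual_grad_est M mu (pi t) (lamu t) - gradient (dual M tau mu) (lamu t).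

Lemma run_step l t : (t < T)%N -> box B l ->
  dual M tau mu (lamb t.+1) + mu / 2 * dot (l - lam t.+1) (l - lam t.+1) <=
  (1 - alpha) * (dual M tau mu (lamb t) + mu / 2 * dot (l - lam t) (l - lam t)) +
  alpha * (lagrangian M (pi t.+1) l + gap t.+1 + tau * ln #|A|%:R / (1 - gamma) +
    mu / 2 * dot l l + 2 * (Num.sqrt m%:R * B) * norm2 (grad_err t.+1)).
Proof.
move=> tT lB; set z := lamu t.+1.
have zB : box B z := run_box_under tT.
have [yB ybB] := run_box tT.
have g1 : 1 - gamma != 0 by rewrite gt_eqF.
have L10 : 0 <= Ld - mu by have := le_mu_Ld; lra.
have La : (Ld - mu + mu) * alpha ^+ 2 = mu / 2.
  rewrite (alpha_sqr mu0 le_mu_Ld alphaE) subrK; field.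
  by rewrite gt_eqF// (lt_le_trans mu0 le_mu_Ld).
have zE : (1 + alpha) *: z = lamb t + alpha *: lam t.
  rewrite /z (ar_cpo_lamu run tT) (mix_stepE mu0 le_mu_Ld alphaE qE).
  by apply/rowP => i; rewrite !mxE; field; rewrite gt_eqF// addr_gt0.
have gsE : gradient (dual M tau mu) z = dual_grad_est M mu (soft z) z := dual_gradient M tau0 mu z.
have k0 : 0 <= 4 * L_nu CM beta - 1 by move: L_nu1; move: (L_nu CM beta) => x x1; lra.
have span := state_value_span_ergodic zB ergodic L_nu1.
have Ha := @dual_smooth R S A m M tau tau0 z (lamb t.+1) _ span k0 mu.
have Hb := dual_subgradient M tau0 mu z (lamb t).
rewrite -gsE in Ha Hb.
rewrite (_ : (1 + (4 * L_nu CM beta - 1)) * R_max M ^+ 2 /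
    (2 * (1 - gamma) ^+ 2 * tau) = Ld - mu) in Ha; last first.
  by rewrite LdE; field; rewrite g1 gt_eqF.
have Hd := box_prox (ltW (eta_gt0 mu0 le_mu_Ld alphaE etaE)) (ltW mu0) lB (ar_cpo_lam run tT).
have e := alpha_eta mu0 le_mu_Ld alphaE etaE.
have scaled X Y Z : mu * (1 - alpha) * (eta * X + 2^-1 * Y + (eta * mu + 1) / 2 * Z) =
    alpha * X + mu * (1 - alpha) / 2 * Y + mu / 2 * Z.
  transitivity (mu * (1 - alpha) * eta * X + mu * (1 - alpha) / 2 * Y +
    (mu * (mu * (1 - alpha) * eta) + mu * (1 - alpha)) / 2 * Z); first by field.
  by rewrite e; ring.
have {}Hd : alpha * (dot (dual_grad_est M mu (pi t.+1) z) (lam t.+1) +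
      mu / 2 * dot (lam t.+1 - z) (lam t.+1 - z)) +
    mu * (1 - alpha) / 2 * dot (lam t.+1 - lam t) (lam t.+1 - lam t) +
    mu / 2 * dot (l - lam t.+1) (l - lam t.+1) <=
    alpha * (dot (dual_grad_est M mu (pi t.+1) z) l + mu / 2 * dot (l - z) (l - z)) +
    mu * (1 - alpha) / 2 * dot (l - lam t) (l - lam t).
  have mt : 0 <= mu * (1 - alpha) by apply: mulr_ge0; [exact: ltW|rewrite subr_ge0 ltW].
  have scaled0 X Y : mu * (1 - alpha) * (eta * X + 2^-1 * Y) =
    alpha * X + mu * (1 - alpha) / 2 * Y by have := scaled X Y 0; rewrite !mulr0 !addr0.
  by rewrite -scaled -scaled0; exact: ler_wpM2l.
have := @accelerated_step R m mu (Ld - mu) alpha (dual M tau mu (lamb t.+1)) (dual M tau mu z)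
  (dual M tau mu (lamb t)) (lamb t) (lam t) (lam t.+1) z l (dual_grad_est M mu (pi t.+1) z)
  (gradient (dual M tau mu) z) mu0 a0 a1 L10 La zE.
rewrite /= -(ar_cpo_lamb run tT) => /(_ Ha Hb Hd) step.
apply: le_trans step _.
  rewrite lerD2l ler_pM2l//.
  (* In this form the entropy of [pi t.+1] cancels between its two regularized Lagrangians; only
     that of the soft policy at [z] remains, bounded by log |A| / (1 - gamma). *)
  have -> : dual M tau mu z + dot (l - z) (dual_grad_est M mu (pi t.+1) z) +
      mu / 2 * dot (l - z) (l - z) =
      reg_lagrangian M tau mu (pi t.+1) l + (dual M tau mu z - reg_lagrangian M tau mu (pi t.+1) z).
    by rewrite (reg_lagrangian_shift M tau mu (pi t.+1) z l); ring.
  have err : dot (grad_err t.+1) (z - lam t.+1) <=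
      2 * (Num.sqrt m%:R * B) * norm2 (grad_err t.+1).
    apply: le_trans (dot_norm2 _ _) _; rewrite mulrC ler_wpM2r ?sqrtr_ge0//.
    exact: box_dist.
  have ent := ler_wpM2l (ltW tau0) (entropy_le M (soft z)).
  rewrite (dualE M tau0 mu z) /reg_lagrangian norm2_sqr.
  rewrite -/(grad_err t.+1).
  have -> : gap t.+1 = lagrangian M (soft z) z - lagrangian M (pi t.+1) z by [].
  rewrite mulrA in ent.
  lra.
Qed.

(* dual (lamb 0) = dual 0 is attained at the soft-optimal policy for lamu 1 = 0, hence the weight
   of [pi 1] in the mixture and the correction term in [dot l]. *)
Lemma run_bound l D e : (0 < T)%N -> box B l ->
  (forall t, (0 < t <= T)%N -> gap t <= D) ->
  (forall t, (0 < t <= T)%N -> norm2 (grad_err t) <= e) ->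
  dual M tau mu (lamb T) <= mixture T alpha (fun t => lagrangian M (pi t) l) -
    (1 - alpha) ^+ T * dot l (V M (pi 1%N) - threshold M) +
    (D + tau * ln #|A|%:R / (1 - gamma) + mu / 2 * dot l l + 2 * (Num.sqrt m%:R * B) * e).
Proof.
move=> T0 lB gapD erre; set c := (X in _ <= _ + X); set w := dot l _.
pose E t := dual M tau mu (lamb t) + mu / 2 * dot (l - lam t) (l - lam t).
pose P t := lagrangian M (pi t) l.
have r0 : 0 <= 2 * (Num.sqrt m%:R * B) by rewrite !mulr_ge0 ?sqrtr_ge0.
have step t : (t < T)%N -> E t.+1 <= (1 - alpha) * E t + alpha * (P t.+1 + c).
  move=> tT; apply: le_trans (run_step tT lB) _; rewrite lerD2l ler_pM2l//.
  have h1 : gap t.+1 <= D by apply: gapD.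
  have h2 := ler_wpM2l r0 (erre t.+1 tT).
  rewrite /c -/(P _); move: h1 h2; move: (gap _) (norm2 _) => x y h1 h2; lra.
have E0 : E 0%N <= P 1%N - w + c.
  rewrite /E (ar_cpo_lam0 run) (ar_cpo_lamb0 run) subr0 (dualE M tau0).
  have h1 : gap 1%N <= D by apply: gapD.
  have h2 := ler_wpM2l r0 (le_trans (sqrtr_ge0 _) (erre 1%N T0)).
  have ent := ler_wpM2l (ltW tau0) (entropy_le M (soft 0)).
  have -> : P 1%N - w = V0 M (pi 1%N) by rewrite /P /w /lagrangian addrK.
  move: h1; rewrite /gap (run_lamu1 T0) /reg_lagrangian /lagrangian norm2_sqr !dot0l !addr0.
  rewrite mulr0 in h2; rewrite mulrA in ent; rewrite mulr0 addr0 /c.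
  move: (V0 M _) (V0 M _) (entropy M _) ent h2 => x y z ent h2 h1; lra.
have EP t : (t < T)%N -> E t.+1 <= mixture t.+1 alpha P - (1 - alpha) ^+ t.+1 * w + c.
  have a10 : 0 <= 1 - alpha by rewrite subr_ge0 ltW.
  elim: t => [|t IH] tT; apply: le_trans (step _ tT) _.
    by rewrite mixture1 expr1; have := ler_wpM2l a10 E0; lra.
  by rewrite mixtureS// [_ ^+ t.+2]exprS; have := ler_wpM2l a10 (IH (ltnW tT)); lra.
case: (T) T0 EP => // T' _ /(_ T' (ltnSn _)); apply: le_trans.
rewrite /E lerDl mulr_ge0 ?dot_ge0// divr_ge0// ltW//.
Qed.

End Run.

(* AM-GM on [2 * rho + 2 * b / eta]. *)
Lemma grad_err_bound (R : realType) (b rho eta d s : R) :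
  0 <= b -> 0 <= d -> d <= rho -> 0 < eta -> 0 <= s -> s ^+ 2 = 8 * eta * b * d ->
  2 * b * d <= s * (2 * rho + 2 * b / eta).
Proof.
move=> b0 d0 dr eta0 s0 sE.
have c0 : 0 <= b / eta by rewrite divr_ge0// ltW.
apply: (le_trans (y := s * (2 * d + 2 * (b / eta)))); last first.
  by rewrite -mulrA; apply: ler_wpM2l => //; lra.
have l0 : 0 <= 2 * b * d by rewrite !mulr_ge0.
have r0 : 0 <= s * (2 * d + 2 * (b / eta)) by rewrite mulr_ge0// addr_ge0// mulr_ge0.
rewrite -(ler_pXn2r (n := 2)) ?nnegrE// [leRHS]exprMn sE.
have -> : 8 * eta * b * d * (2 * d + 2 * (b / eta)) ^+ 2 =
  8 * eta * b * d * 4 * (d - b / eta) ^+ 2 + 128 * (b * d) ^+ 2.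
  by field; rewrite gt_eqF.
have h1 : 0 <= 8 * eta * b * d * 4 * (d - b / eta) ^+ 2.
  by rewrite mulr_ge0 ?sqr_ge0// !mulr_ge0// ltW.
by have := sqr_ge0 (b * d); lra.
Qed.

Theorem theorem1 (R : realType) (S A : finType) (m : nat) (M : cmdp R S A m)
  (xi tau mu delta CM beta B Ld alpha q eta : R) (T : nat)
  (pi : nat -> policy R S A) (lamu lam lamb : nat -> 'rV[R]_m)
  (pit : policy R S A) (lamstar : 'rV[R]_m)
  (tau_gt0 : 0 < tau) (mu_gt0 : 0 < mu) (T_gt0 : (0 < T)%N)
  (BE : B = r0_max M / ((1 - discount M) * xi))
  (LdE : Ld = 2 * R_max M ^+ 2 * L_nu CM beta / ((1 - discount M) ^+ 2 * tau) + mu)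
  (alphaE : alpha = Num.sqrt (mu / (2 * Ld)))
  (qE : q = (2 * alpha - mu / Ld) / (2 - mu / Ld))
  (etaE : eta = alpha / (mu * (1 - alpha)))
  (slater_xi : slater M xi)
  (ergodic : uniformly_ergodic M tau B CM beta)
  (* automatic if #|S| > 1 or 1 <= CM: see L_nu_ge1 *)
  (nondegenerate : 1 <= L_nu CM beta)
  (run : ar_cpo M T eta alpha q tau mu delta B pi lamu lam lamb)
  (output : is_output M T alpha pi pit)
  (lamstarP : is_argmin (@nonneg_orthant R m) (dual M tau mu) lamstar) :
  let Delta t :=
    V0 M (soft_policy M tau (lamu t)) +
      dot (lamu t) (V M (soft_policy M tau (lamu t)) - threshold M) -
    (V0 M (pi t) + dot (lamu t) (V M (pi t) - threshold M)) in
  let grad_err t :=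
    dual_grad_est M mu (pi t) (lamu t) - gradient (dual M tau mu) (lamu t) in
  let K0 l :=
    dual M tau mu (lamb 0%N) - dual M tau mu l +
      alpha / 2 * (mu + eta^-1) * norm2 (lam 0%N - l) ^+ 2 in
  let max_Delta := \big[Num.max/0]_(1 <= t < T.+1) `|Delta t| in
  let max_grad_err := \big[Num.max/0]_(1 <= t < T.+1) norm2 (grad_err t) in
  let sqrtm := Num.sqrt (m%:R : R) in
  let zeta :=
    2 * (1 - Num.sqrt (mu / (2 * Ld))) `^ (T%:R / 2) * Num.sqrt (eta * K0 lamstar) +
      Num.sqrt (8 * eta * sqrtm * B * max_grad_err) in
  V0_opt M - V0 M pit <=
    zeta * (2 * R_max M / (1 - discount M) + 2 * sqrtm * B / eta) +
    Num.sqrt (2 * Ld / mu) * max_Delta +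
    tau * ln (#|A|%:R) / (1 - discount M) +
    6 * mu * m%:R * B ^+ 2
  /\
  norm1 (pospart (threshold M - V M pit)) <=
    zeta * (2 * R_max M / ((1 - discount M) * B) + 2 * sqrtm / eta) +
    Num.sqrt (2 * Ld / mu) * (max_Delta / B) +
    tau * ln (#|A|%:R) / ((1 - discount M) * B) +
    6 * mu * m%:R * B +
    2 * (1 - Num.sqrt (mu / (2 * Ld))) ^+ (T - 1) * (sqrtm * R_max M / (1 - discount M)).


Proof.
move=> Delta grad_err K0 max_Delta max_grad_err sqrtm zeta.
have g0 : 0 < 1 - discount M by rewrite subr_gt0 discount_lt1.
have [xi0 [pis slat]] := slater_xi.
have sfeas : feasible M pis by move=> i; have := slat i; lra.
have r0max : 0 < r0_max M.
  have [s _] : exists s : S, True.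
    have [s _|noS] := pickP (@predT S); first by exists s.
    by have := dist_sum1 (init M); rewrite big_pred0// => /eqP; rewrite eq_sym oner_eq0.
  have [a _] := card_gt0P (action_gt0 M).
  exact: lt_le_trans (reward0_gt0 M s a) (max_rewardP (reward0 M) s a).
have B0 : 0 < B by rewrite BE divr_gt0// mulr_gt0.
have muLd := le_mu_Ld tau_gt0 LdE nondegenerate.
have a0 := alpha_gt0 mu_gt0 muLd alphaE; have a1 := alpha_lt1 mu_gt0 muLd alphaE.
have a01 : 0 <= alpha <= 1 by rewrite !ltW.
have eta0 := eta_gt0 mu_gt0 muLd alphaE etaE.
have D0 t : (0 < t <= T)%N -> Delta t <= max_Delta.
  move=> tT; apply: le_trans (ler_norm _) _.
  by apply: (le_bigmax_seq _ t xpredT (fun t => `|Delta t|)) => //; rewrite mem_index_iota ltnS.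
have E0 t : (0 < t <= T)%N -> norm2 (grad_err t) <= max_grad_err.
  move=> tT.
  by apply: (le_bigmax_seq _ t xpredT (fun t => norm2 (grad_err t))) => //;
    rewrite mem_index_iota ltnS.
have e0 : 0 <= max_grad_err by exact: bigmax_ge_id.
have Dpos : 0 <= max_Delta by exact: bigmax_ge_id.
have Rg0 : 0 <= R_max M / (1 - discount M) by rewrite divr_ge0 ?sqrtr_ge0// ltW.
(* In the gradient error the thresholds and the terms in [mu] cancel, leaving a difference of two
   value vectors. This is the bound d <= rho required by [grad_err_bound]. *)
have eR : max_grad_err <= R_max M / (1 - discount M).
  apply: bigmax_le => // t _; rewrite /grad_err dual_gradient//.
  rewrite /dual_grad_est.
  rewrite (_ : _ - _ = V M (pi t) - V M (soft_policy M tau (lamu t))); first exact: V_dist.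
  by rewrite opprD addrACA subrr addr0 opprB addrA subrK.
have b0 : 0 <= sqrtm * B by rewrite mulr_ge0 ?sqrtr_ge0// ltW.
pose s := Num.sqrt (8 * eta * sqrtm * B * max_grad_err).
have zs : s <= zeta.
  by rewrite /zeta lerDr mulr_ge0 ?sqrtr_ge0// mulr_ge0// powR_ge0.
have err : 2 * (sqrtm * B) * max_grad_err <=
    zeta * (2 * (R_max M / (1 - discount M)) + 2 * (sqrtm * B) / eta).
  have h : 2 * (sqrtm * B) * max_grad_err <=
      s * (2 * (R_max M / (1 - discount M)) + 2 * (sqrtm * B) / eta).
    apply: grad_err_bound => //; first exact: sqrtr_ge0.
    by rewrite sqr_sqrtr -?mulrA// !mulr_ge0// ?(ltW eta0) ?(ltW B0) ?sqrtr_ge0.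
  apply: le_trans h _; apply: ler_wpM2r => //.
  apply: addr_ge0; first exact: mulr_ge0.
  by apply: divr_ge0; [exact: mulr_ge0|exact: ltW].
have key l : box B l -> V0_opt M <= lagrangian M pit l -
    (1 - alpha) ^+ T * dot l (V M (pi 1%N) - threshold M) +
    (max_Delta + tau * ln #|A|%:R / (1 - discount M) + mu / 2 * dot l l +
      2 * (sqrtm * B) * max_grad_err).
  move=> lB; rewrite -(output_lagrangian l T_gt0 a01 output).
  apply: le_trans (run_bound tau_gt0 mu_gt0 (ltW B0) LdE alphaE qE etaE ergodic
    nondegenerate run T_gt0 lB D0 E0).
  apply: (V0_opt_le_dual tau_gt0 (ltW mu_gt0) sfeas) => i.
  have [_ lbB] := run_box tau_gt0 mu_gt0 (ltW B0) LdE alphaE nondegenerate run (leqnn T).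
  by have /andP[] := lbB i.
(* This square root is 1 / alpha, hence large enough to absorb a single [max_Delta]. *)
have sqrtL : 1 <= Num.sqrt (2 * Ld / mu).
  by rewrite (sqrt_condition mu_gt0 muLd alphaE) invf_ge1// ltW.
have DL : max_Delta <= Num.sqrt (2 * Ld / mu) * max_Delta by rewrite ler_peMl.
have lnA : 0 <= ln #|A|%:R :> R.
  by rewrite ln_ge0// ler1n (action_gt0 M).
split.
  have box0 : box B (0 : 'rV[R]_m) by move=> i; rewrite mxE lexx/= mulr_ge0// ltW.
  have := key _ box0; rewrite /lagrangian !dot0l !mulr0 !addr0 subr0.
  have : 0 <= 6 * mu * m%:R * B ^+ 2 by rewrite !mulr_ge0 ?sqr_ge0// ltW.
  move: err DL; rewrite -!mulrA; lra.
pose v i := Num.max ((threshold M - V M pit) 0 i) 0.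
pose l : 'rV[R]_m := \row_i (if 0 < v i then 2 * B else 0).
have lB : box B l.
  by move=> i; rewrite mxE; case: ifP => _; rewrite lexx ?andbT mulr_ge0// ltW.
set viol := norm1 _; have violE : viol = \sum_i v i by rewrite /viol norm1_pospart.
have lag : lagrangian M pit l = V0 M pit - 2 * B * viol.
  rewrite /lagrangian violE mulr_sumr -sumrN; congr (_ + _); apply: eq_bigr => i _.
  have -> : (V M pit - threshold M) 0 i = - (threshold M - V M pit) 0 i by rewrite !mxE opprB.
  rewrite [l 0 i]mxE.
  have [h|h] := leP ((threshold M - V M pit) 0 i) 0.
    have -> : v i = 0 by exact: max_r.
    by rewrite ltxx mul0r mulr0 oppr0.
  have -> : v i = (threshold M - V M pit) 0 i by apply: max_l; exact: ltW.
  by rewrite h mulrN.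
(* The Slater policy bounds the thresholds: c_i <= V_i(pis) <= rmax_i / (1 - gamma), while V_i(pi 1)
   >= 0. Cauchy-Schwarz then produces sqrt m R_max. *)
have first_iterate : - dot l (V M (pi 1%N) - threshold M) <=
    2 * B * (sqrtm * R_max M / (1 - discount M)).
  apply: (le_trans (y := \sum_i 2 * B * (max_reward (reward M i) / (1 - discount M)))).
    rewrite -sumrN; apply: ler_sum => i _.
    have -> : (V M (pi 1%N) - threshold M) 0 i = V M (pi 1%N) 0 i - threshold M 0 i.
      by rewrite !mxE.
    rewrite [l 0 i]mxE.
    have h1 := V_ge0 M (pi 1%N) i; have h2 := V_le M pis i; have h3 := slat i.
    have h4 : 0 <= V M pis 0 i by exact: V_ge0.
    have B2 : 0 <= 2 * B by rewrite mulr_ge0// ltW.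
    case: ifP => _; last by rewrite mul0r oppr0; apply: mulr_ge0 => //; lra.
    by rewrite -mulrN opprB; apply: ler_wpM2l => //; lra.
  rewrite -mulr_sumr -mulr_suml; apply: ler_wpM2l; first by rewrite mulr_ge0// ltW.
  by rewrite ler_pM2r ?invr_gt0// sum_max_reward.
have th0 : 0 <= 1 - alpha by rewrite subr_ge0 ltW.
have powT : (1 - alpha) ^+ T <= (1 - alpha) ^+ (T - 1).
  by apply: ler_wiXn2l; rewrite ?th0//; [lra|rewrite leq_subr].
have Y0 : 0 <= 2 * B * (sqrtm * R_max M / (1 - discount M)).
  by rewrite -mulrA !mulr_ge0 ?invr_ge0 ?sqrtr_ge0// ltW.
have firstT : - ((1 - alpha) ^+ T * dot l (V M (pi 1%N) - threshold M)) <=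
    (1 - alpha) ^+ (T - 1) * (2 * B * (sqrtm * R_max M / (1 - discount M))).
  rewrite -mulrN; apply: le_trans (ler_wpM2l (exprn_ge0 _ th0) first_iterate) _.
  exact: ler_wpM2r.
(* [lower] loses B times the violation and [upper] gains 2B times it; the difference bounds B times
   the violation, hence the scaling of the goal by [B]. *)
have lower := V0_opt_ge pit slater_xi; rewrite -BE -/viol in lower.
have upper := key l lB; rewrite lag in upper.
(* Coordinates are at most 2B, so mu/2 |l|^2 <= 2 mu m B^2, within the 6 mu m B^2 of the claim. *)
have ll := ler_wpM2l (ltW mu_gt0) (box_sqr (ltW B0) lB).
rewrite -alphaE -(ler_pM2l B0).
have -> : B * (zeta * (2 * R_max M / ((1 - discount M) * B) + 2 * sqrtm / eta) +
    Num.sqrt (2 * Ld / mu) * (max_Delta / B) +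
    tau * ln #|A|%:R / ((1 - discount M) * B) + 6 * mu * m%:R * B +
    2 * (1 - alpha) ^+ (T - 1) * (sqrtm * R_max M / (1 - discount M))) =
  zeta * (2 * (R_max M / (1 - discount M)) + 2 * (sqrtm * B) / eta) +
  Num.sqrt (2 * Ld / mu) * max_Delta + tau * ln #|A|%:R / (1 - discount M) +
  6 * (mu * m%:R * B ^+ 2) +
  (1 - alpha) ^+ (T - 1) * (2 * B * (sqrtm * R_max M / (1 - discount M))).
  by field; rewrite !gt_eqF.
have mB : 0 <= mu * m%:R * B ^+ 2 by rewrite !mulr_ge0 ?sqr_ge0// ltW.
have {}ll : mu / 2 * dot l l <= 2 * (mu * m%:R * B ^+ 2) by lra.
move: lower upper ll mB firstT err DL.
move: (_ ^+ (T - 1) * _) (_ ^+ T * _) (mu / 2 * _) (mu * m%:R * _) (_ * max_grad_err)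
  (zeta * _) (_ * max_Delta) (tau * _ / _) (V0 M _) (V0_opt M).
move=> x1 x2 x3 x4 x5 x6 x7 x8 x9 x10; lra.
Qed.
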